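(* Let $K$ be an oriented classical link with diagram $D$, and let $\Gamma_p = 1+(p+1)\sum_{i=1}^{p-1}u^i \in \mathbb{Z}[C_p]$. Then $$\Phi_\phi(K) = \Gamma_p^{\,r}\, p^{2s},$$ where $r$ is the rank of the Hermitian form $\eta$ on $\mathrm{Rep}(K,\mathbb{E}_p)$ and $s = \nu_h(K)+\nu_0(K)-r$ is its nullity. Further, $s>0$.
   Context: Let $p$ be a prime, and let $\mathbb{F}_p\subset\mathbb{E}_p$ be the finite fields with $p$ and $p^2$ elements. For $x\in\mathbb{E}_p$, $\bar x$ is the conjugate of $x$ over $\mathbb{F}_p$. Fix $\theta\in\mathbb{E}_p$ with $\mathbb{E}_p=\mathbb{F}_p(\theta)$ and $\theta\bar\theta=1$; its minimal polynomial over $\mathbb{F}_p$ is $h=t^2+\kappa t+1$. Fix a non-zero $\mathfrak{i}\in\mathbb{E}_p$ with $\bar{\mathfrak{i}}=-\mathfrak{i}$, and define $\phi\colon\mathbb{E}_p^2\to\mathbb{F}_p$ by $\phi(x,y)=\mathfrak{i}(x\bar y-\bar x y)$. Let $\Lambda_p=\mathbb{F}_p[t,t^{-1}]$, and make $\mathbb{E}_p$ a $\Lambda_p$-module by $tx=\theta x$. Let $K$ be an oriented link in $S^3$ with diagram $D$. At each crossing $c$ let $\omega(c)$ be the overcrossing arc, $\lambda(c)$ the undercrossing arc to the left of $\omega(c)$, $\rho(c)$ the undercrossing arc to the right of $\omega(c)$, and $\mathrm{sign}(c)=\pm1$ the sign of the crossing. The Alexander module $A_p(K)=H_1(\tilde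 X,\tilde X_0;\mathbb{F}_p)$ ($\tilde X$ the infinite cyclic cover of the exterior of $K$, $\tilde X_0$ a fiber of it) is the $\Lambda_p$-module generated by the arcs of $D$ with one relation $\lambda(c)=t\rho(c)+(1-t)\omega(c)$ for each crossing $c$. Let $\nu_h(K)$ be the number of $h$-torsion factors $\Lambda_p/(h^e)$, $e\ge1$, in the primary decomposition of $A_p(K)$, and $\nu_0(K)$ the (free) rank of $A_p(K)$ over the PID $\Lambda_p$. Put $\mathrm{Rep}(K,\mathbb{E}_p)=\mathrm{Hom}_{\Lambda_p}(A_p(K),\mathbb{E}_p)$, an $\mathbb{E}_p$-vector space of dimension $\nu_h(K)+\nu_0(K)$. Define $\eta(f,g)=\sum_c \mathrm{sign}(c)\,\mathfrak{i}\bigl(f\rho(c)\overline{g\omega(c)}-f\omega(c)\overline{g\rho(c)}\bigr)$ for $f,g\in\mathrm{Rep}(K,\mathbb{E}_p)$, the sum being over all crossings of $D$; this is a Hermitian form with respect to $x\mapsto\bar x$. The Boltzmann weight is $B(f)=\sum_c\mathrm{sign}(c)\,\phi(f\rho(c),f\omega(c))=\eta(f,f)\in\mathbb{F}_p$. Let $C_p$ be a multiplicative cyclic group of order $p$ with generator $u$; the cocycle invariant is $\Phi_\phi(K)=\sum_{f\in\mathrm{Rep}(K,\mathbb{E}_p)}u^{B(f)}\in\mathbb{Z}[C_p]$. *)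

(* Defs.v *)
From HB Require Import structures.
From mathcomp Require Import all_boot all_order all_algebra all_fingroup all_solvable all_field.
From mathcomp Require Import boolp.

Set Implicit Arguments.
Unset Strict Implicit.
Unset Printing Implicit Defensive.

Import GRing.Theory.

Local Open Scope ring_scope.
Local Open Scope quotient_scope.

(* The alias hides the pointwise product that finite functions inherit. *)
Definition group_ring (gT : finGroupType) : Type := {ffun gT -> int}.

Section GroupRing.
Variable gT : finGroupType.
Local Notation ZG := (group_ring gT).

HB.instance Definition _ := GRing.Zmodule.copy ZG {ffun gT -> int}.

Definition gr_elt (x : gT) : ZG := [ffun y => (x == y)%:R].
Definition gr_mul (a b : ZG) : ZG := [ffun z => \sum_x a x * b (x^-1 * z)%g].

Lemma gr_mulA : associative gr_mul.
Proof.
move=> a b c; apply/ffunP=> z; rewrite !ffunE.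
under eq_bigr => x _ do rewrite ffunE mulr_sumr.
under [RHS]eq_bigr => y _ do rewrite ffunE mulr_suml.
rewrite [RHS]exchange_big /=; apply: eq_bigr => x _.
rewrite [RHS](reindex_inj (mulgI x)) /=; apply: eq_bigr => y _.
by rewrite mulKg invMg -mulgA mulrA.
Qed.

Lemma gr_mul1 : left_id (gr_elt 1%g) gr_mul.
Proof.
move=> a; apply/ffunP=> z; rewrite ffunE (bigD1 1%g) //= big1 => [|x ne].
  by rewrite ffunE eqxx mul1r invg1 mul1g addr0.
by rewrite ffunE eq_sym (negPf ne) mul0r.
Qed.

Lemma gr_mulr1 : right_id (gr_elt 1%g) gr_mul.
Proof.
move=> a; apply/ffunP=> z; rewrite ffunE (bigD1 z) //= big1 => [|x ne].
  by rewrite ffunE mulVg eqxx mulr1 addr0.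
by rewrite ffunE eq_sym -eq_mulVg1 (negPf ne) mulr0.
Qed.

Lemma gr_mulDl : left_distributive gr_mul +%R.
Proof.
move=> a b c; apply/ffunP=> z; rewrite !ffunE -big_split /=.
by apply: eq_bigr => x _; rewrite ffunE mulrDl.
Qed.

Lemma gr_mulDr : right_distributive gr_mul +%R.
Proof.
move=> a b c; apply/ffunP=> z; rewrite !ffunE -big_split /=.
by apply: eq_bigr => x _; rewrite ffunE mulrDr.
Qed.

HB.instance Definition _ := GRing.Zmodule_isPzRing.Build ZG
  gr_mulA gr_mul1 gr_mulr1 gr_mulDl gr_mulDr.

End GroupRing.

Section Laurent.
Variable F : fieldType.

Definition laurent_pred (x : {fraction {poly F}}) : bool :=
  `[< exists (q : {poly F}) (n : nat), x = tofrac q / tofrac 'X^n >].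

Lemma tofracXn_neq0 n : tofrac ('X^n : {poly F}) != 0.
Proof. by rewrite tofrac_eq0 monic_neq0 // monicXn. Qed.

Lemma laurent_pred_subring : subring_closed laurent_pred.
Proof.
split=> [|x y|x y]; rewrite -!topredE /=.
- by apply/asboolP; exists 1, 0%N; rewrite expr0 tofrac1 divr1.
- move=> /asboolP[q [n ->]] /asboolP[r [m ->]]; apply/asboolP.
  exists (q * 'X^m - r * 'X^n), (n + m)%N.
  rewrite tofracB !tofracM exprD tofracM -mulNr addf_div ?tofracXn_neq0 //.
  by rewrite mulNr.
move=> /asboolP[q [n ->]] /asboolP[r [m ->]]; apply/asboolP.
by exists (q * r), (n + m)%N; rewrite tofracM exprD tofracM mulf_div.
Qed.

HB.instance Definition _ :=
  GRing.isSubringClosed.Build {fraction {poly F}} laurent_pred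
    laurent_pred_subring.

Record laurent := Laurent { laurent_val : {fraction {poly F}};
                            _ : laurent_val \in laurent_pred }.

HB.instance Definition _ := [isSub for laurent_val].
HB.instance Definition _ := [Choice of laurent by <:].
HB.instance Definition _ := [SubChoice_isSubComNzRing of laurent by <:].

Lemma poly_laurent_subproof (q : {poly F}) : tofrac q \in laurent_pred.
Proof. by apply/asboolP; exists q, 0%N; rewrite expr0 tofrac1 divr1. Qed.

Definition poly_laurent (q : {poly F}) : laurent :=
  Laurent (poly_laurent_subproof q).

Lemma laurent_fracP (x : laurent) :
  exists qn : {poly F} * nat, val x = tofrac qn.1 / tofrac 'X^(qn.2).
Proof. by case: x => x /= /asboolP[q [n ->]]; exists (q, n). Qed.

Variables (A : fieldExtType F) (theta : A).

(* The ring morphism F[t, t^-1] -> A with t |-> theta; see laurent_evalE. *)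
Definition laurent_eval (x : laurent) : A :=
  let qn := projT1 (cid (laurent_fracP x)) in
  horner_alg theta qn.1 / theta ^+ qn.2.

Hypothesis theta_neq0 : theta != 0.

Lemma laurent_evalE (x : laurent) q n :
  val x = tofrac q / tofrac 'X^n ->
  laurent_eval x = horner_alg theta q / theta ^+ n.
Proof.
rewrite /laurent_eval; case: (cid _) => -[r m] /= -> /eqP.
rewrite eqr_div ?tofracXn_neq0 // -!tofracM tofrac_eq => /eqP/(congr1 (horner_alg theta)).
rewrite !rmorphM !rmorphXn /= horner_algX => e.
by apply/eqP; rewrite eqr_div ?expf_neq0 // e.
Qed.

Lemma laurent_evalD : {morph laurent_eval : x y / x + y}.
Proof.
move=> x y; have [[q n] /= qE] := laurent_fracP x; have [[r m] /= rE] := laurent_fracP y.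
rewrite (laurent_evalE qE) (laurent_evalE rE) addf_div ?expf_neq0 //.
rewrite (@laurent_evalE _ (q * 'X^m + r * 'X^n) (n + m)).
  by rewrite rmorphD !rmorphM !rmorphXn /= horner_algX exprD.
rewrite /= qE rE addf_div ?tofracXn_neq0 //.
by rewrite tofracD !tofracM exprD tofracM.
Qed.

Lemma laurent_evalM : {morph laurent_eval : x y / x * y}.
Proof.
move=> x y; have [[q n] /= qE] := laurent_fracP x; have [[r m] /= rE] := laurent_fracP y.
rewrite (laurent_evalE qE) (laurent_evalE rE) mulf_div.
rewrite (@laurent_evalE _ (q * r) (n + m)) ?rmorphM ?exprD //=.
by rewrite qE rE mulf_div !tofracM.
Qed.

Lemma laurent_eval1 : laurent_eval 1 = 1.
Proof.
by rewrite (@laurent_evalE _ 1 0) ?rmorph1 ?expr0 ?divr1.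
Qed.

End Laurent.

Definition laurent_t (F : fieldType) : laurent F := poly_laurent 'X.

Section Coker.
Variables (R : nzRingType) (M : lmodType R) (C : finType) (r : C -> M).

Definition span_pred (v : M) : bool :=
  `[< exists a : C -> R, v = \sum_c a c *: r c >].

Lemma span_pred_submod : submod_closed span_pred.
Proof.
split=> [|a x y]; rewrite -!topredE /=.
  by apply/asboolP; exists (fun=> 0); rewrite big1 // => c _; rewrite scale0r.
move=> /asboolP[b ->] /asboolP[d ->]; apply/asboolP.
exists (fun c => a * b c + d c); rewrite scaler_sumr -big_split /=.
by apply: eq_bigr => c _; rewrite scalerDl scalerA.
Qed.

HB.instance Definition _ :=
  GRing.isZmodClosed.Build M span_pred
    (GRing.submod_closedB span_pred_submod).
HB.instance Definition _ :=
  GRing.isScaleClosed.Build R M span_pred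
    (GRing.subsemimod_closedZ (GRing.submod_closed_semi span_pred_submod)).

Local Notation Q := (Quotient.quot (GRing.ZmodClosed.clone M span_pred _)).
Definition coker : Type := Q.
HB.instance Definition _ := GRing.Zmodule.copy coker Q.

Definition coker_proj (v : M) : coker := \pi_Q v.
Definition coker_scale (a : R) (x : coker) : coker :=
  coker_proj (a *: generic_quotient.repr (x : Q)).

Lemma coker_projE v w : (coker_proj v == coker_proj w) = (v - w \in span_pred).
Proof. by rewrite Quotient.idealrBE. Qed.

Lemma coker_projD : {morph coker_proj : v w / v + w}.
Proof. exact: (raddfD \pi_Q). Qed.

Lemma coker_projK (x : coker) : exists v, x = coker_proj v.
Proof.
by exists (generic_quotient.repr (x : Q)); rewrite /coker_proj reprK.
Qed.

Lemma coker_projZ a v : coker_scale a (coker_proj v) = coker_proj (a *: v).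
Proof.
apply/eqP; rewrite coker_projE -scalerBr rpredZ //.
by rewrite -coker_projE /coker_proj reprK.
Qed.

Lemma coker_scaleA a b x : coker_scale a (coker_scale b x) = coker_scale (a * b) x.
Proof. by have [v ->] := coker_projK x; rewrite !coker_projZ scalerA. Qed.

Lemma coker_scale1 : left_id 1 coker_scale.
Proof. by move=> x; have [v ->] := coker_projK x; rewrite coker_projZ scale1r. Qed.

Lemma coker_scaleDr : right_distributive coker_scale +%R.
Proof.
move=> a x y; have [v ->] := coker_projK x; have [w ->] := coker_projK y.
by rewrite -coker_projD !coker_projZ -coker_projD scalerDr.
Qed.

Lemma coker_scaleDl x : {morph coker_scale^~ x : a b / a + b}.
Proof.
move=> a b /=; have [v ->] := coker_projK x.
by rewrite !coker_projZ -coker_projD scalerDl.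
Qed.

HB.instance Definition _ := GRing.Zmodule_isLmodule.Build R coker
  coker_scaleA coker_scale1 coker_scaleDr coker_scaleDl.

End Coker.

Section Presentation.
Variables (R : nzRingType) (I C : finType).

Definition free_gen (i : I) : {ffun I -> R^o} := [ffun j => (i == j)%:R].

Definition presented_module (r : C -> {ffun I -> R^o}) : lmodType R := coker r.

Definition module_gen (r : C -> {ffun I -> R^o}) (i : I) : presented_module r :=
  coker_proj r (free_gen i).

End Presentation.

Section Primary.
Variable R : comNzRingType.

Definition divides (a b : R) : Prop := exists c, b = c * a.
Definition associates (a b : R) : Prop := divides a b /\ divides b a.
Definition prime_elt (q : R) : Prop :=
  [/\ q != 0, ~ divides q 1
    & forall a b, divides q (a * b) -> divides q a \/ divides q b].

(* [None] stands for the free factor R, [Some (q, e)] for R/(q^e). *)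
Definition factor : Type := option (R * nat).
Definition factor_wf (x : factor) : Prop :=
  if x is Some (q, e) then prime_elt q /\ (0 < e)%N else True.
Definition factor_modulus (x : factor) : R :=
  if x is Some (q, e) then q ^+ e else 0.

Variable M : lmodType R.

(* M is isomorphic to the direct sum of the R/(d_i), d_i the modulus of the
   i-th factor: the map R^n -> M, a |-> \sum_i a_i g_i, is onto with kernel
   the product of the ideals (d_i). *)
Definition primary_decomposition (fs : seq factor) : Prop :=
  (forall i : 'I_(size fs), factor_wf (nth None fs i)) /\
  exists g : 'I_(size fs) -> M,
    (forall x, exists a : 'I_(size fs) -> R, x = \sum_i a i *: g i) /\
    (forall a : 'I_(size fs) -> R, \sum_i a i *: g i = 0 <->
       forall i : 'I_(size fs), divides (factor_modulus (nth None fs i)) (a i)).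

(* The junk value [::] is never used when R is a PID and M is finitely
   generated; uniqueness of the decomposition makes the choice immaterial. *)
Definition primary_factors : seq factor :=
  match pselect (exists fs, primary_decomposition fs) with
  | left ex => projT1 (cid ex)
  | right _ => [::]
  end.

Definition free_rank : nat :=
  count (fun x : factor => x == None) primary_factors.

Definition torsion_count (h : R) : nat :=
  count (fun x : factor => if x is Some (q, _) then `[< associates q h >] else false)
    primary_factors.

End Primary.

(* A passage (c, b) is a traversal of the crossing c, along the overcrossing
   strand if b = true and along the undercrossing strand if b = false;
   [next_passage] sends a passage to the one that follows it along the
   oriented link.  The edges of the underlying 4-valent graph are the segments
   between two successive passages; an edge is represented by the passage it
   leaves from.  [circles] counts the components with neither over- nor
   undercrossings. *)
Record gauss_diagram := GaussDiagram {
  crossing : finType;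
  positive : crossing -> bool;
  next_passage : {perm crossing * bool};
  circles : nat
}.

Section GaussDiagram.
Variable D : gauss_diagram.
Local Notation C := (crossing D).

Definition passage : finType := (C * bool)%type.
Definition prev_passage (x : passage) : passage := (next_passage D)^-1%g x.

(* The half-edges of the underlying graph are the pairs (passage, b), with
   b = true for the outgoing half-edge and b = false for the incoming one. *)
Definition half_edge : finType := (passage * bool)%type.

Definition opposite (d : half_edge) : half_edge :=
  if d.2 then (next_passage D d.1, false) else (prev_passage d.1, true).

(* The next half-edge counterclockwise around the same crossing.  The order is
   over-out, under-out, over-in, under-in at a positive crossing, and
   over-out, under-in, over-in, under-out at a negative one. *)
Definition rotate (d : half_edge) : half_edge :=
  let: (c, over, out) := d in
  (c, ~~ over, if over == positive c then out else ~~ out).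

Definition face_next (d : half_edge) : half_edge := rotate (opposite d).

Definition adjacent : rel C := fun c d =>
  [exists b, exists b', (next_passage D (c, b) == (d, b'))
                     || (next_passage D (d, b) == (c, b'))].

(* Euler's formula V - E + F = 2 k, k the number of connected components of
   the underlying graph: every component embeds in the sphere. *)
Definition planar : bool :=
  (#|C| + fcard face_next half_edge == #|passage| + 2 * n_comp adjacent C)%N.

(* The edges x and y are consecutive at an overpassage. *)
Definition over_joined : rel passage := fun x y =>
  ((next_passage D x == y) && y.2) || ((next_passage D y == x) && x.2).

Definition arc_edges (x : passage) : {set passage} :=
  [set y | connect over_joined x y].

Lemma arc_edges_in x : arc_edges x \in [set arc_edges y | y : passage].
Proof. exact: imset_f. Qed.

(* An arc is a maximal union of edges consecutive at overpassages, or a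
   component without crossings. *)
Definition arc : finType :=
  ({A : {set passage} | A \in [set arc_edges y | y : passage]}
   + 'I_(circles D))%type.

Definition arc_of (x : passage) : arc := inl (Sub (arc_edges x) (arc_edges_in x)).

Definition over_arc (c : C) : arc := arc_of (c, true).
Definition under_in (c : C) : arc := arc_of (prev_passage (c, false)).
Definition under_out (c : C) : arc := arc_of (c, false).

(* At a positive crossing the undercrossing strand goes from the right to the
   left of the overcrossing one. *)
Definition left_arc (c : C) : arc :=
  if positive c then under_out c else under_in c.
Definition right_arc (c : C) : arc :=
  if positive c then under_in c else under_out c.

Definition sign (R : pzRingType) (c : C) : R := if positive c then 1 else -1.

End GaussDiagram.

Arguments sign {D} R c.

Record link_diagram := LinkDiagram {
  link_gauss :> gauss_diagram;
  link_planar : planar link_gauss;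
  link_nonempty : (0 < #|crossing link_gauss| + circles link_gauss)%N
}.

Section Alexander.
Variables (p : nat) (D : gauss_diagram).
Local Notation Lambda := (laurent 'F_p).
Local Notation t := (laurent_t 'F_p).
Local Notation "[ a ]" := (@free_gen Lambda (arc D) a).

Definition alexander_relation (c : crossing D) : {ffun arc D -> Lambda^o} :=
  [left_arc c] - (t *: [right_arc c] + (1 - t) *: [over_arc c]).

(* The Fox presentation of H_1 of the infinite cyclic cover of the link
   exterior relative to a fiber, with coefficients in F_p. *)
Definition alexander_module : lmodType Lambda :=
  presented_module alexander_relation.

Definition arc_gen (a : arc D) : alexander_module :=
  module_gen alexander_relation a.

Definition nu_0 : nat := free_rank alexander_module.
Definition nu (h : {poly 'F_p}) : nat :=
  torsion_count alexander_module (poly_laurent h).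

End Alexander.

(* The nontrivial automorphism of a field with p^2 elements is the Frobenius. *)
Definition conj (p : nat) (E : fieldExtType 'F_p) (x : E) : E := x ^+ p.

Lemma norm1_neq0 (p : nat) (E : fieldExtType 'F_p) (theta : E) :
  theta * conj theta = 1 -> theta != 0.
Proof. by apply: contra_eqN => /eqP ->; rewrite mul0r eq_sym oner_neq0. Qed.

Definition theta_module (p : nat) (E : fieldExtType 'F_p) (theta : E)
  of theta != 0 : Type := E.

Section ThetaModule.
Variables (p : nat) (E : fieldExtType 'F_p) (theta : E) (nz : theta != 0).
Local Notation ET := (theta_module nz).

HB.instance Definition _ := GRing.Zmodule.copy ET E.

Definition theta_scale (a : laurent 'F_p) (x : ET) : ET :=
  laurent_eval theta a * (x : E).

Lemma theta_scaleA a b x : theta_scale a (theta_scale b x) = theta_scale (a * b) x.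
Proof. by rewrite /theta_scale laurent_evalM // mulrA. Qed.
Lemma theta_scale1 : left_id 1 theta_scale.
Proof. by move=> x; rewrite /theta_scale laurent_eval1 // mul1r. Qed.
Lemma theta_scaleDr : right_distributive theta_scale +%R.
Proof. by move=> a x y; rewrite /theta_scale -mulrDr. Qed.
Lemma theta_scaleDl x : {morph theta_scale^~ x : a b / a + b}.
Proof. by move=> a b; rewrite /theta_scale laurent_evalD // mulrDl. Qed.

HB.instance Definition _ := GRing.Zmodule_isLmodule.Build (laurent 'F_p) ET
  theta_scaleA theta_scale1 theta_scaleDr theta_scaleDl.

End ThetaModule.

Section Rep.
Variables (p : nat) (E : fieldExtType 'F_p) (theta : E) (nz : theta != 0).
Variable D : gauss_diagram.
Local Notation A := (alexander_module p D).
Local Notation ET := (theta_module nz).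

Definition Rep : Type := {linear A -> ET}.

Definition rep_at (f : Rep) (a : arc D) : E := f (arc_gen p a).

(* A representation is determined by its values on the arcs, which gives the
   finite type structure of Rep. *)
Definition rep_values (f : Rep) : {ffun arc D -> finvect_type E} :=
  [ffun a => rep_at f a].

Lemma rep_eqP (f g : Rep) : (forall x, f x = g x) -> f = g.
Proof.
case: f g => f [[fA] [fZ]] [g [[gA] [gZ]]] /= fg.
have e : f = g by apply/funext.
case: g / e gA gZ {fg} => gA gZ.
by rewrite (Prop_irrelevance fA gA) (Prop_irrelevance fZ gZ).
Qed.

Lemma rep_values_inj : injective rep_values.
Proof.
move=> f g /ffunP fg; apply: rep_eqP => x.
have [v ->] := coker_projK x.
have -> : coker_proj (@alexander_relation p D) v = \sum_a v a *: arc_gen p a.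
  have -> : v = \sum_a v a *: free_gen (laurent 'F_p) a.
    apply/ffunP=> b; rewrite sum_ffunE (bigD1 b) //= big1 ?addr0.
      by rewrite !ffunE eqxx /GRing.scale /= mulr1.
    by move=> a ne; rewrite !ffunE (negPf ne) scaler0.
  have lin : linear (coker_proj (@alexander_relation p D)).
    by move=> a x1 x2; rewrite coker_projD -coker_projZ.
  pose L : {linear _ -> A} := HB.pack (coker_proj (@alexander_relation p D))
    (GRing.isLinear.Build _ _ _ _ _ lin).
  rewrite -[LHS]/(L _) linear_sum; apply: eq_bigr => a _; rewrite linearZ /=.
  congr (_ *: _); rewrite sum_ffunE (bigD1 a) //= big1 ?addr0.
    by rewrite !ffunE eqxx /GRing.scale /= mulr1.
  by move=> b ne; rewrite !ffunE (negPf ne) scaler0.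
rewrite !linear_sum; apply: eq_bigr => a _; rewrite !linearZ /=.
by have := fg a; rewrite !ffunE /rep_at => ->.
Qed.

Definition rep_of_values (v : {ffun arc D -> finvect_type E}) : option Rep :=
  match pselect (exists f, rep_values f = v) with
  | left ex => Some (projT1 (cid ex))
  | right _ => None
  end.

Lemma rep_valuesK : pcancel rep_values rep_of_values.
Proof.
move=> f; rewrite /rep_of_values; case: pselect => [ex|]; last by case; exists f.
by congr Some; apply: rep_values_inj; case: cid.
Qed.

HB.instance Definition _ := Finite.copy Rep (pcan_type rep_valuesK).

Definition mk_rep (f : A -> ET) (lin : linear f) : Rep :=
  HB.pack f (GRing.isLinear.Build _ _ _ _ f lin).

Lemma rep_zero_linear : linear (fun _ : A => 0 : ET).
Proof. by move=> a x y; rewrite scaler0 addr0. Qed.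
Lemma rep_opp_linear (f : Rep) : linear (fun x : A => - f x : ET).
Proof. by move=> a x y; rewrite linearP opprD scalerN. Qed.
Lemma rep_add_linear (f g : Rep) : linear (fun x : A => f x + g x : ET).
Proof. by move=> a x y; rewrite !linearP scalerDr addrACA. Qed.
Lemma rep_scale_linear (k : E) (f : Rep) :
  linear (fun x : A => k * (f x : E) : ET).
Proof. by move=> a x y; rewrite linearP [LHS]mulrDr [k * _]mulrCA. Qed.

Definition rep_zero : Rep := mk_rep rep_zero_linear.
Definition rep_opp (f : Rep) : Rep := mk_rep (rep_opp_linear f).
Definition rep_add (f g : Rep) : Rep := mk_rep (rep_add_linear f g).
Definition rep_scale (k : E) (f : Rep) : Rep := mk_rep (rep_scale_linear k f).

Lemma rep_addA : associative rep_add.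
Proof. by move=> f g h; apply: rep_eqP => x; apply: addrA. Qed.
Lemma rep_addC : commutative rep_add.
Proof. by move=> f g; apply: rep_eqP => x; apply: addrC. Qed.
Lemma rep_add0 : left_id rep_zero rep_add.
Proof. by move=> f; apply: rep_eqP => x; apply: add0r. Qed.
Lemma rep_addN : left_inverse rep_zero rep_opp rep_add.
Proof. by move=> f; apply: rep_eqP => x; apply: addNr. Qed.

HB.instance Definition _ :=
  GRing.isZmodule.Build Rep rep_addA rep_addC rep_add0 rep_addN.

Lemma rep_scaleA k l f : rep_scale k (rep_scale l f) = rep_scale (k * l) f.
Proof. by apply: rep_eqP => x; apply: mulrA. Qed.
Lemma rep_scale1 : left_id 1 rep_scale.
Proof. by move=> f; apply: rep_eqP => x; apply: mul1r. Qed.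
Lemma rep_scaleDr : right_distributive rep_scale +%R.
Proof. by move=> k f g; apply: rep_eqP => x; apply: mulrDr. Qed.
Lemma rep_scaleDl f : {morph rep_scale^~ f : k l / k + l}.
Proof. by move=> k l; apply: rep_eqP => x; apply: mulrDl. Qed.

HB.instance Definition _ := GRing.Zmodule_isLmodule.Build E Rep
  rep_scaleA rep_scale1 rep_scaleDr rep_scaleDl.

Definition rep_vector (f : Rep) : {ffun arc D -> E^o} := rep_values f.

Lemma rep_vector_linear : linear rep_vector.
Proof. by move=> k f g; apply/ffunP=> a; rewrite !ffunE. Qed.

HB.instance Definition _ :=
  GRing.isLinear.Build E Rep {ffun arc D -> E^o} _ rep_vector rep_vector_linear.

Definition rep_space : {vspace {ffun arc D -> E^o}} :=
  <<[seq rep_vector f | f : Rep]>>%VS.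

Lemma rep_spaceP v : v \in rep_space -> exists f, v = rep_vector f.
Proof.
move=> /coord_span ->.
elim/big_rec: _ => [|i w _ [f ->]]; first by exists 0; rewrite linear0.
set x := _`_i; have [g ->] : exists g, x = rep_vector g.
  have /mapP[g _ e] : x \in [seq rep_vector f | f : Rep].
    by apply: mem_nth; rewrite size_tuple.
  by exists g.
by eexists (_ *: g + f); rewrite linearP.
Qed.

Lemma rep_vector_axiom : Vector.axiom (\dim rep_space) Rep.
Proof.
pose X := vbasis rep_space.
have inW f : rep_vector f \in rep_space.
  by apply/memv_span/map_f; rewrite mem_enum.
exists (fun f => \row_i coord X i (rep_vector f)).
  by move=> k f g; apply/rowP=> i; rewrite !mxE linearP linearP.
pose V (u : 'rV_(\dim rep_space)) := \sum_i u 0 i *: X`_i.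
have VW u : V u \in rep_space.
  by apply: rpred_sum => i _; rewrite rpredZ // vbasis_mem // mem_nth // size_tuple.
exists (fun u => projT1 (cid (rep_spaceP (VW u)))) => [f|u].
  case: cid => g /= e; apply: rep_values_inj.
  rewrite -[LHS]/(rep_vector g) -[RHS]/(rep_vector f) -e /V.
  by rewrite [RHS](coord_vbasis (inW f)); apply: eq_bigr => i _; rewrite mxE.
case: cid => g /= <-; apply/rowP=> i.
by rewrite mxE coord_sum_free // (basis_free (vbasisP _)).
Qed.

HB.instance Definition _ := Lmodule_hasFinDim.Build E Rep rep_vector_axiom.

End Rep.

Section FormRank.
Variables (K : fieldType) (V : vectType K) (form : V -> V -> K).

Definition gram_matrix : 'M[K]_(\dim {:V}) :=
  \matrix_(i, j) form (vbasis {:V})`_i (vbasis {:V})`_j.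

Definition form_rank : nat := \rank gram_matrix.

Definition is_radical (W : {vspace V}) : Prop :=
  forall f, f \in W <-> forall g, form f g = 0.

End FormRank.

(* The element of F_p that maps to x in E; only used when there is one. *)
Definition to_Fp (p : nat) (E : fieldExtType 'F_p) (x : E) : 'F_p :=
  odflt 0 [pick a : 'F_p | a%:A == x].

Definition phi (p : nat) (E : fieldExtType 'F_p) (ii x y : E) : 'F_p :=
  to_Fp (ii * (x * conj y - conj x * y)).

Section Invariant.
Variables (p : nat) (E : fieldExtType 'F_p) (theta : E) (nz : theta != 0).
Variables (ii : E) (D : gauss_diagram).
Local Notation Rep := (Rep nz D).

Definition eta (f g : Rep) : E :=
  \sum_(c : crossing D) sign E c *
    (ii * (rep_at f (right_arc c) * conj (rep_at g (over_arc c))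
           - rep_at f (over_arc c) * conj (rep_at g (right_arc c)))).

Definition boltzmann_weight (f : Rep) : 'F_p :=
  \sum_(c : crossing D) sign 'F_p c *
    phi ii (rep_at f (right_arc c)) (rep_at f (over_arc c)).

Definition cocycle_invariant (gT : finGroupType) (u : gT) : group_ring gT :=
  \sum_(f : Rep) gr_elt (u ^+ boltzmann_weight f)%g.

End Invariant.

Definition Gamma (p : nat) (gT : finGroupType) (u : gT) : group_ring gT :=
  1 + p.+1%:R * \sum_(1 <= i < p) gr_elt (u ^+ i)%g.

(* Main.v *)
From HB Require Import structures.
From Pilot Require Import Defs.
From mathcomp Require Import all_boot all_order all_algebra all_fingroup all_solvable all_field.
From mathcomp Require Import boolp.
From mathcomp Require Import ring zify.
(* [path] also defines [arc], [left_arc] and [right_arc]. *)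
Import Pilot.Defs.

(* The Boltzmann weight is f |-> eta(f, f), so its distribution only depends on
   the Hermitian form eta. All nonzero values are taken equally often, say N_1
   times, because the norm E_p -> F_p is onto. The square of N_0 - N_1 is a
   squared Gauss sum, equal to |V| times the order of the radical, and its sign
   is read modulo p + 1, since the norm-one group, of order p + 1, acts freely
   on the vectors of value 1. The dimension nu_h + nu_0 of Rep comes from the
   primary decomposition over the Euclidean ring F_p[t, t^-1]. Constant
   representations lie in the radical: the terms of eta against a constant
   telescope along the components of the link, whence s > 0. *)

Set Implicit Arguments.
Unset Strict Implicit.
Unset Printing Implicit Defensive.

Import GRing.Theory.

Local Open Scope ring_scope.

(** * Finitely generated modules over Euclidean rings *)

(** [Gamma] equals [(p + 1) gr_norm - p], where [gr_norm] is the sum of all group elements, and the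
    square of [gr_norm] is [p gr_norm]. So the powers of [Gamma] lie in the span of 1 and [gr_norm],
    as does any sum of powers of [u] whose nonzero exponents are equally frequent. Such an element
    is fixed by two integers: its value at every nontrivial character, here N_0 - N_1, and its
    augmentation, here |V|. For [Gamma] they are -p and p^2, which explains the constant p + 1. The
    formula thus reduces to N_0 - N_1 = (-p)^r p^(2s) and |V| = p^(2(r+s)). The Gauss sum treats
    degenerate forms and the prime 2 like all others, without an orthogonal basis. The numbers nu_h
    and nu_0 are read off a chosen decomposition of the Alexander module. Hence one must be shown to
    exist, and the dimension count must work for whichever was chosen: each free factor, and each
    torsion factor whose prime is associate to h, carries one dimension of maps to E_p. *)

Lemma exists_argmin (T : Type) (P : T -> Prop) (f : T -> nat) :
  (exists x, P x) -> exists2 x, P x & forall y, P y -> (f x <= f y)%N.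
Proof.
case=> x Px; move: {2}(f x) (leqnn (f x)) => n.
elim: n x Px => [|n IH] x Px le_xn.
  by exists x => // y _; move: le_xn; rewrite leqn0 => /eqP ->.
case: (pselect (exists2 y, P y & (f y < f x)%N)) => [[y Py lt_yx]|no].
  by apply: (IH y) => //; rewrite -ltnS (leq_trans lt_yx).
by exists x => // y Py; rewrite leqNgt; apply/negP => lt_yx; apply: no; exists y.
Qed.

(** * Bezout relations and primes in Euclidean domains *)

Section Divisibility.
Variable R : comNzRingType.
Implicit Types a b c q : R.

Lemma divides_refl a : divides a a.
Proof. by exists 1; rewrite mul1r. Qed.

Lemma divides_trans a b c : divides a b -> divides b c -> divides a c.
Proof. by case=> x -> [y ->]; exists (y * x); rewrite mulrA. Qed.

(** Monotonicity along divisibility is included because it makes proper divisors strictly smaller,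
    which drives the inductions on [delta]. *)
Definition euclidean (delta : R -> nat) : Prop :=
  [/\ forall a b, a * b = 0 -> a = 0 \/ b = 0,
      forall a b, b != 0 -> divides a b -> (delta a <= delta b)%N
    & forall a b, b != 0 ->
        exists q r, a = q * b + r /\ (r = 0 \/ (delta r < delta b)%N)].

Variable delta : R -> nat.
Hypothesis eR : euclidean delta.

Lemma euclid_mulIr a b c : c != 0 -> a * c = b * c -> a = b.
Proof.
have [dom _ _] := eR.
move=> c0 e; have /dom[/subr0_eq//|c00] : (a - b) * c = 0.
  by rewrite mulrBl e subrr.
by rewrite c00 eqxx in c0.
Qed.

Lemma euclid_minimal (P : R -> Prop) g :
  (forall a b c, P a -> P b -> P (a - c * b)) ->
  P g -> g != 0 -> (forall b, P b -> b != 0 -> (delta g <= delta b)%N) ->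
  forall a, P a -> divides g a.
Proof.
move=> PB Pg g0 gmin a Pa; have [_ _ dv] := eR.
have [q [r [aE rP]]] := dv a g g0.
have Pr : P r.
  by have -> : r = a - q * g; [rewrite aE addrC addKr | apply: PB].
case: rP => [r0|lt_r]; first by exists q; rewrite aE r0 addr0.
have [r0|r0] := eqVneq r 0; first by exists q; rewrite aE r0 addr0.
by have := gmin r Pr r0; rewrite leqNgt lt_r.
Qed.

Lemma euclid_bezout a b :
  exists g x y, [/\ divides g a, divides g b & g = x * a + y * b].
Proof.
have [/andP[/eqP-> /eqP->]|nz] := boolP ((a == 0) && (b == 0)).
  by exists 0, 0, 0; split; try exact: divides_refl; rewrite !mul0r addr0.
pose I g := exists x y, g = x * a + y * b.
have Ia : I a by exists 1, 0; rewrite mul1r mul0r addr0.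
have Ib : I b by exists 0, 1; rewrite mul1r mul0r add0r.
have : exists g : R, I g /\ g != 0.
  by move: nz; rewrite negb_and => /orP[]; [exists a|exists b].
case/(exists_argmin delta) => g [Ig g0] gmin.
have gI : forall c, I c -> divides g c.
  apply: (euclid_minimal (P := I)) => // [c d k [x [y ->]] [z [w ->]]|c Ic c0].
    by exists (x - k * z), (y - k * w); ring.
  by apply: gmin.
have [x [y gE]] := Ig; exists g, x, y; split=> //; exact: gI.
Qed.

(** The remainder of [a] modulo its multiple [b] is again a multiple of [a]. If it is nonzero,
    monotonicity forbids it to be smaller than [a]. *)
Lemma euclid_divides_lt a b :
  b != 0 -> divides a b -> ~ divides b a -> (delta a < delta b)%N.
Proof.
move=> b0 [c bE] nba; rewrite ltnNge; apply/negP => le_ba; apply: nba.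
have [_ mono dv] := eR; have [q [r [aE [r0|lt_r]]]] := dv a b b0.
  by exists q; rewrite aE r0 addr0.
have [r0|r0] := eqVneq r 0; first by exists q; rewrite aE r0 addr0.
have rE : r = (1 - q * c) * a.
  by have -> : r = a - q * b; [rewrite aE addrC addKr | rewrite bE; ring].
have /(mono a r r0) : divides a r by exists (1 - q * c).
by rewrite leqNgt (leq_trans lt_r).
Qed.

(** A nonunit divisor [q] of minimal size is prime: its gcd with [a] is either a unit, and then
    Bezout gives that [q] divides [b], or by minimality a multiple of [q]. *)
Lemma euclid_prime_divisor d :
  d != 0 -> ~ divides d 1 -> exists2 q : R, prime_elt q & divides q d.
Proof.
move=> d0 dU.
have : exists q : R, divides q d /\ ~ divides q 1.
  by exists d; split=> //; exact: divides_refl.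
case/(exists_argmin delta) => q [qd qU] qmin; exists q => //.
have q0 : q != 0.
  by apply/eqP => q0; case: qd => c; rewrite q0 mulr0 => /eqP; rewrite (negPf d0).
split=> // a b [c abE].
have [g [x [y [gq ga gE]]]] := euclid_bezout q a.
case: (pselect (divides g 1)) => [[k kE]|gU].
  right; exists (k * x * b + k * y * c).
  have -> : (k * x * b + k * y * c) * q = k * x * q * b + k * y * (c * q) by ring.
  by rewrite -abE -[LHS]mul1r kE gE; ring.
left; apply: divides_trans ga.
case: (pselect (divides q g)) => // nqg.
have := qmin g (Logic.conj (divides_trans gq qd) gU).
by rewrite leqNgt (euclid_divides_lt q0 gq nqg).
Qed.

(** For exponent one, write [q = c * g] with [g] the gcd of [q] and [d]; primality makes [g] a unit
    or a multiple of [q]. Higher exponents come from multiplying Bezout relations. *)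
Lemma prime_coprime_expn q d e : prime_elt q -> ~ divides q d ->
  exists x y, x * q ^+ e + y * d = 1.
Proof.
move=> [q0 qU qP] qd.
have [x1 [y1 e1]] : exists x y, x * q + y * d = 1.
  have [g [x [y [[c qE] gd gE]]]] := euclid_bezout q d.
  have /qP[[k cE]|qg] : divides q (c * g) by rewrite -qE; exact: divides_refl.
  - have kg : 1 = k * g.
      by apply: (euclid_mulIr q0); rewrite mul1r {1}qE cE; ring.
    by exists (k * x), (k * y); rewrite -!mulrA -mulrDr -gE -kg.
  - by case: qd; apply: divides_trans qg gd.
elim: e => [|e [x [y xyE]]]; first by exists 1, 0; rewrite expr0; ring.
exists (x * x1), (x * q ^+ e * y1 + y * (x1 * q + y1 * d)).
rewrite exprS -[RHS]mulr1 -{1}e1 -xyE; ring.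
Qed.

Lemma euclid_extract_prime q d : prime_elt q -> d != 0 -> divides q d ->
  exists e d', [/\ (0 < e)%N, d = q ^+ e * d' & ~ divides q d'].
Proof.
move=> qpr; have [q0 qU qP] := qpr.
have [n] := ubnP (delta d); elim: n d => // n IH d; rewrite ltnS => le_dn d0 [c dE].
case: (pselect (divides q c)) => [qc|nqc]; last first.
  by exists 1%N, c; rewrite expr1 mulrC.
have c0 : c != 0 by apply: contra_neq d0 => c0; rewrite dE c0 mul0r.
have lt_cd : (delta c < delta d)%N.
  apply: euclid_divides_lt => //; first by exists q; rewrite mulrC.
  case=> k cE; apply: qU; exists k; apply: (euclid_mulIr c0).
  by rewrite mul1r {1}cE dE; ring.
have [e [d' [e0 cE nd']]] := IH c (leq_trans lt_cd le_dn) c0 qc.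
by exists e.+1, d'; split=> //; rewrite dE cE exprS; ring.
Qed.

End Divisibility.

(** * Existence of primary decompositions *)

Section Decomposition.
Variables (R : comNzRingType) (delta : R -> nat).
Hypothesis eR : euclidean delta.
Variable M : lmodType R.
Implicit Types (P Q : M -> Prop) (s : seq M) (fs : seq (factor R)).

Definition submodule P : Prop :=
  P 0 /\ forall a x y, P x -> P y -> P (a *: x + y).

Definition span s : M -> Prop := fun x =>
  forall P, submodule P -> (forall y, y \in s -> P y) -> P x.

Lemma submodule_span s : submodule (span s).
Proof.
split=> [P [] //|a x y sx sy P sP Ps].
by apply: sP.2; [apply: sx | apply: sy].
Qed.

Lemma submoduleD P x y : submodule P -> P x -> P y -> P (x + y).
Proof. by move=> [_ sP] Px Py; rewrite -[x]scale1r; apply: sP. Qed.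

Lemma submoduleZ P a x : submodule P -> P x -> P (a *: x).
Proof. by move=> [P0 sP] Px; rewrite -[_ *: _]addr0; apply: sP. Qed.

Lemma submoduleB P x y : submodule P -> P x -> P y -> P (x - y).
Proof. by move=> [_ sP] Px Py; rewrite addrC -scaleN1r; apply: sP. Qed.

Lemma mem_span s x : x \in s -> span s x.
Proof. by move=> xs P _; apply. Qed.

Lemma span_sub s1 s2 : (forall y, y \in s1 -> span s2 y) ->
  forall x, span s1 x -> span s2 x.
Proof. by move=> s12 x; apply => //; exact: submodule_span. Qed.

Lemma span_nil x : span [::] x <-> x = 0.
Proof.
split=> [|->]; last exact: (submodule_span [::]).1.
by move/(_ (fun z => z = 0)); apply=> //; split=> // a y z -> ->; rewrite scaler0 addr0.
Qed.

Lemma span_cons y s x : span (y :: s) x <-> exists a z, span s z /\ x = a *: y + z.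
Proof.
split=> [|[a [z [sz ->]]]].
  move/(_ (fun x => exists a z, span s z /\ x = a *: y + z)); apply=> [|z]; first split.
  - by exists 0, 0; split; rewrite ?scale0r ?addr0 //; exact: (submodule_span s).1.
  - move=> a _ _ [b [z [sz ->]]] [c [w [sw ->]]].
    exists (a * b + c), (a *: z + w); split; first exact: (submodule_span s).2.
    by rewrite scalerDr scalerDl scalerA addrACA.
  rewrite inE => /predU1P[->|zs].
    exists 1, 0; rewrite scale1r addr0; split=> //; exact: (submodule_span s).1.
  by exists 0, z; rewrite scale0r add0r; split=> //; apply: mem_span.
apply: (submodule_span _).2; first by apply: mem_span; rewrite mem_head.
by apply: span_sub sz => w ws; apply: mem_span; rewrite inE ws orbT.
Qed.

(* [P] is an internal direct sum of cyclic modules with moduli [fs], the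
   summands being peeled off one at a time. *)
Fixpoint splits P fs : Prop :=
  if fs is f :: fs' then
    factor_wf f /\ exists y Q,
      [/\ splits Q fs',
          forall x, P x <-> exists a z, Q z /\ x = a *: y + z,
          forall a z, Q z -> a *: y + z = 0 -> divides (factor_modulus f) a /\ z = 0
        & factor_modulus f *: y = 0]
  else forall x, P x <-> x = 0.

Lemma splits_submodule P fs : splits P fs -> submodule P.
Proof.
elim: fs P => [|f fs IH] P /=.
  by move=> P0; split=> [|a x y]; rewrite !P0 // => -> ->; rewrite scaler0 addr0.
case=> _ [y [Q [/IH[Q0 sQ] PE _ _]]]; split=> [|a x x'].
  by apply/PE; exists 0, 0; rewrite scale0r addr0.
rewrite !PE => -[b [z [Qz ->]]] [c [w [Qw ->]]].
exists (a * b + c), (a *: z + w); split; first exact: sQ.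
by rewrite scalerDr scalerDl scalerA addrACA.
Qed.

Lemma splits_eq P Q fs : (forall x, P x <-> Q x) -> splits P fs -> splits Q fs.
Proof. by move=> PQ; have -> : P = Q by apply/funext => x; apply/propext. Qed.

Lemma splits_cat P Q S fs gs :
  splits P fs -> splits Q gs -> (forall x, P x -> Q x -> x = 0) ->
  (forall x, S x <-> exists y z, [/\ P y, Q z & x = y + z]) ->
  splits S (fs ++ gs).
Proof.
elim: fs P S => [|f fs IH] P S /=.
  move=> P0 sQ _ SE; apply: splits_eq sQ => x; rewrite SE; split=> [Qx|].
    by exists 0, x; split=> //; [apply/P0 | rewrite add0r].
  by case=> y [z [/P0 -> Qz ->]]; rewrite add0r.
case=> wf [y [P' [sP' PE ind fy]]] sQ PQ SE; split=> //.
have P'P x : P' x -> P x by move=> P'x; apply/PE; exists 0, x; rewrite scale0r add0r.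
exists y, (fun x => exists z w, [/\ P' z, Q w & x = z + w]); split=> //.
- apply: IH sP' sQ _ _ => // x P'x Qx; apply: PQ => //; exact: P'P.
- move=> x; rewrite SE; split=> [[_ [w [/PE[a [z [P'z ->]]] Qw ->]]]|].
    by exists a, (z + w); rewrite addrA; split=> //; exists z, w.
  case=> a [_ [[z [w [P'z Qw ->]]] ->]]; exists (a *: y + z), w.
  by rewrite addrA; split=> //; apply/PE; exists a, z.
move=> a _ [z [w [P'z Qw ->]]] e; have smQ := splits_submodule sQ.
have w0 : w = 0.
  apply: PQ => //; apply/PE; exists (- a), (- z); split.
    by have := submoduleB (splits_submodule sP') (splits_submodule sP').1 P'z; rewrite sub0r.
  by apply/eqP; rewrite scaleNr -opprD -addr_eq0 addrC -addrA e.
rewrite w0 addr0 in e *; exact: ind.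
Qed.

(** Chinese remainder theorem: if [d = q ^+ e * d'] with coprime factors, then [d' *: y] generates a
    copy of R/(q^e) and [q ^+ e *: y] a copy of R/(d'), and the Bezout relation shows that their sum
    is direct and everything. The induction continues with [d']. *)
Lemma splits_cyclic d y : d != 0 -> (forall a, a *: y = 0 <-> divides d a) ->
  exists fs, splits (fun x => exists a, x = a *: y) fs.
Proof.
have [n] := ubnP (delta d).
elim: n d y => // n IH d y; rewrite ltnS => le_dn d0 ann.
case: (pselect (divides d 1)) => [/ann|dU].
  rewrite scale1r => y0; exists [::] => x; split=> [[a ->]|->].
    by rewrite y0 scaler0.
  by exists 0; rewrite scale0r.
have [q qpr qd] := euclid_prime_divisor eR d0 dU.
have [e [d' [e0 dE nqd]]] := euclid_extract_prime eR qpr d0 qd.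
have [u [v uv]] := prime_coprime_expn eR e qpr nqd.
have d'0 : d' != 0 by apply: contra_neq d0 => d'0; rewrite dE d'0 mulr0.
have qe0 : q ^+ e != 0 by apply: contra_neq d0 => qe0; rewrite dE qe0 mul0r.
have lt_d : (delta d' < delta d)%N.
  apply: (euclid_divides_lt eR) => //; first by exists (q ^+ e).
  case=> k d'E; have [_ qU _] := qpr; apply: qU; exists (k * q ^+ e.-1).
  apply: (euclid_mulIr eR d'0).
  by rewrite mul1r {1}d'E dE -{1}(prednK e0) exprS; ring.
have ann' a : a *: (q ^+ e *: y) = 0 <-> divides d' a.
  rewrite scalerA ann dE; split=> [[k /eqP]|[k ->]]; last by exists k; ring.
  by rewrite [q ^+ e * d']mulrC mulrA => /eqP/(euclid_mulIr eR qe0) ->; exists k.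
have [fs sfs] := IH d' _ (leq_trans lt_d le_dn) d'0 ann'.
exists (Some (q, e) :: fs); split=> //.
exists (d' *: y), (fun x => exists a, x = a *: (q ^+ e *: y)); split=> //.
- move=> x; split=> [[a ->]|[a [_ [[b ->] ->]]]].
    exists (a * v), (a *: (u *: (q ^+ e *: y))); split.
      by exists (a * u); rewrite scalerA.
    by rewrite !scalerA -scalerDl -{1}[a]mulr1 -uv; congr (_ *: _); ring.
  by exists (a * d' + b * q ^+ e); rewrite scalerDl !scalerA.
- move=> a _ [b ->]; rewrite !scalerA -scalerDl => /ann[k]; rewrite dE => e1.
  have bE : b = (b * v + k * q ^+ e * u - a * u) * d'.
    have -> : (b * v + k * q ^+ e * u - a * u) * d'
       = b * (v * d') + u * (k * (q ^+ e * d')) - u * a * d' by ring.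
    by rewrite -e1 -{1}[b]mulr1 -uv; ring.
  have aE : a = (a * u + k * d' * v - b * v) * q ^+ e.
    have -> : (a * u + k * d' * v - b * v) * q ^+ e
       = a * (u * q ^+ e) + v * (k * (q ^+ e * d')) - v * b * q ^+ e by ring.
    by rewrite -e1 -{1}[a]mulr1 -uv; ring.
  split; first by rewrite /= aE; exists (a * u + k * d' * v - b * v).
  by rewrite -scalerA; apply/ann'; rewrite bE; exists (b * v + k * q ^+ e * u - a * u).
rewrite /= scalerA; apply/ann; rewrite dE; exact: divides_refl.
Qed.

Lemma span_perm s1 s2 x : perm_eq s1 s2 -> span s1 x -> span s2 x.
Proof. by move=> /perm_mem e; apply: span_sub => y; rewrite e; exact: mem_span. Qed.

(* A nonzero coefficient [a] of a relation among [n.+1] generators that is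
   minimal over all generating sequences divides the other coefficients, so a
   change of generators turns the relation into [a *: y = 0]. *)
Lemma span_split s0 n :
  size s0 = n.+1 ->
  exists y s, [/\ size s = n, forall x, span s0 x <-> span (y :: s) x &
    (forall a, span s (a *: y) -> a = 0) \/
    exists2 d, d != 0 /\ d *: y = 0 & forall a, span s (a *: y) -> divides d a].
Proof.
move=> size_s0.
pose T (t : R * M * seq M) := let: (a, y, s) := t in
  [/\ a != 0, size s = n, forall x, span s0 x <-> span (y :: s) x & span s (a *: y)].
case: (pselect (exists t, T t)) => [ex|no]; last first.
  case: s0 size_s0 @T no => [//|y s] [ss] T no; exists y, s; split=> //; left=> a sa.
  by apply/eqP; apply/negPn/negP => a0; apply: no; exists (a, y, s).
have [[[a y] s] [a0 ss sE say] amin] := exists_argmin (fun t => delta t.1.1) ex.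
have min b z s' : size s' = n -> (forall x, span s0 x <-> span (z :: s') x) ->
    span s' (b *: z) -> b = 0 \/ (delta a <= delta b)%N.
  have [->|b0] := eqVneq b 0; first by left.
  by move=> *; right; apply: (amin (b, z, s')).
have [y' y'E ay'] : exists2 y', (forall x, span s0 x <-> span (y' :: s) x) & a *: y' = 0.
  (* Invariant of the elimination: [s1] holds the generators whose coefficient in the relation has
     been cleared, [s2] those that may still occur in it. *)
  have : exists s1 s2, [/\ s = s1 ++ s2, (forall x, span s0 x <-> span (y :: s) x)
    & span s2 (a *: y)] by exists [::], s.
  case=> s1 [s2 []]; move: {sE say amin} y s1.
  elim: s2 => [|z s2 IH] y s1 sE yE.
    by move/span_nil => ay; exists y.
  case/span_cons=> b [w [sw ayE]]; have [_ _ dv] := eR.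
  have [q [r [bE rP]]] := dv b a a0.
  have yE' x : span s0 x <-> span ((y - q *: z) :: s) x.
    have zs : z \in s by rewrite sE mem_cat mem_head orbT.
    rewrite yE; split; apply: span_sub => v; rewrite inE => /predU1P[->|vs];
      try by apply: mem_span; rewrite inE vs orbT.
      rewrite -{2}[y](subrK (q *: z)); apply: submoduleD (submodule_span _) _ _.
        by apply: mem_span; rewrite mem_head.
      by apply: submoduleZ (submodule_span _) _; apply: mem_span; rewrite inE zs orbT.
    apply: submoduleB (submodule_span _) _ _; first by apply: mem_span; rewrite mem_head.
    by apply: submoduleZ (submodule_span _) _; apply: mem_span; rewrite inE zs orbT.
  have rE : a *: (y - q *: z) = r *: z + w.
    rewrite scalerBr ayE bE scalerDl scalerA [q * a]mulrC.
    by rewrite addrAC [_ *: z + _]addrC addrK.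
  (* Exchanging the roles of [y - q *: z] and [z] turns the relation into one with leading
     coefficient [r], smaller than the minimal [a]. *)
  have r0 : r = 0.
    case: rP => // lt_r; case: (min r z ((y - q *: z) :: s1 ++ s2)).
    - by rewrite -ss sE /= !size_cat /= addnS.
    - move=> x; rewrite yE' sE; split; apply: span_perm;
        by apply/seq.permP => f; rewrite /= !count_cat /=; lia.
    - have -> : r *: z = a *: (y - q *: z) - w by rewrite rE addrK.
      apply: submoduleB (submodule_span _) _ _.
        by apply: submoduleZ (submodule_span _) _; by apply: mem_span; rewrite mem_head.
      by apply: span_sub sw => v vs; apply: mem_span; rewrite !inE mem_cat vs !orbT.
    - by [].
    - by rewrite leqNgt lt_r.
  apply: (IH (y - q *: z) (rcons s1 z)) => //; first by rewrite cat_rcons.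
  by rewrite rE r0 scale0r add0r.
exists y', s; split=> //; right; exists a => // b sb; have [_ _ dv] := eR.
have [q [r [bE rP]]] := dv b a a0.
have : span s (r *: y').
  by move: sb; rewrite bE scalerDl -scalerA ay' scaler0 add0r.
move=> /(min _ _ _ ss y'E) r0.
by exists q; case: rP r0 => [r0 _|lt_r [r0|]]; rewrite ?bE ?r0 ?addr0 // leqNgt lt_r.
Qed.

Lemma splits_span s : exists fs, splits (span s) fs.
Proof.
move: {2}(size s) (erefl (size s)) => n; elim: n s => [|n IH] s0.
  by move/size0nil ->; exists [::] => x; exact: span_nil.
case/span_split=> y [s [/IH[fs sfs] sE yP]].
have sP x : span s0 x <-> exists a z, span s z /\ x = a *: y + z.
  by rewrite sE span_cons.
case: yP => [free|[d [d0 dy] dP]].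
  exists (None :: fs); split=> //; exists y, (span s); split=> // [a z sz e|].
    have a0 : a = 0.
      apply: free; have -> : a *: y = 0 - z by rewrite -e addrK.
      by apply: submoduleB (submodule_span _) _ _ => //; exact: (submodule_span s).1.
    by move: e; rewrite a0 scale0r add0r => ->; split=> //; exists 0; rewrite mul0r.
  by rewrite scale0r.
have ann a : a *: y = 0 <-> divides d a.
  split=> [ay|[k ->]]; last by rewrite -scalerA dy scaler0.
  by apply: dP; rewrite ay; exact: (submodule_span s).1.
have [gs sgs] := splits_cyclic d0 ann; exists (gs ++ fs).
apply: splits_cat sgs sfs _ _ => [x [a ->] /dP/ann //|x].
rewrite sP; split=> [[a [z [sz ->]]]|[_ [z [[a ->] sz ->]]]].
  by exists (a *: y), z; split=> //; exists a.
by exists a, z.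
Qed.

(** Passes from the recursive decomposition to the indexed one of the definitions. The generators
    are indexed by [nat] so that adjoining one is a plain shift. *)
Lemma splits_family P fs : splits P fs ->
  (forall i : 'I_(size fs), factor_wf (nth None fs i)) /\
  exists g : nat -> M,
    (forall x, P x <-> exists a : 'I_(size fs) -> R, x = \sum_i a i *: g i) /\
    (forall a : 'I_(size fs) -> R, \sum_i a i *: g i = 0 <->
       forall i : 'I_(size fs), divides (factor_modulus (nth None fs i)) (a i)).
Proof.
elim: fs P => [|f fs IH] P /=.
  move=> P0; split=> [[]//|]; exists (fun=> 0); split=> [x|a].
    rewrite P0; split=> [->|[a ->]]; last by rewrite big_ord0.
    by exists (fun=> 0); rewrite big_ord0.
  by rewrite big_ord0; split=> // _ [].
case=> wf [y [Q [/IH[wfs [g [gE gP]]] PE ind fy]]]; split.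
  by move=> i; case: (unliftP ord0 i) => [j|] -> //=; apply: wfs.
exists (fun n => if n is m.+1 then g m else y); split=> [x|a].
  rewrite PE; split=> [[a [_ [/gE[b ->] ->]]]|[a ->]].
    exists (fun i => if unlift ord0 i is Some j then b j else a).
    rewrite big_ord_recl unlift_none /=; congr (_ + _).
    by apply: eq_bigr => i _; rewrite liftK.
  rewrite big_ord_recl /=; exists (a ord0), (\sum_i a (lift ord0 i) *: g i).
  by split=> //; apply/gE; exists (fun i => a (lift ord0 i)).
rewrite big_ord_recl /=; split=> [e i|dv].
  have Qs : Q (\sum_i a (lift ord0 i) *: g i) by apply/gE; exists (fun i => a (lift ord0 i)).
  have [d0 s0] := ind _ _ Qs e.
  case: (unliftP ord0 i) => [j|] -> //=.
  by have [/(_ s0 j)] := gP (fun i => a (lift ord0 i)).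
have [k ->] := dv ord0; rewrite -scalerA /= fy scaler0 add0r.
by apply/gP => i; have := dv (lift ord0 i).
Qed.

Theorem primary_decomposition_span s : (forall x, span s x) ->
  exists fs, primary_decomposition M fs.
Proof.
move=> sM; have [fs /splits_family[wf [g [gE gP]]]] := splits_span s.
by exists fs; split=> //; exists (fun i => g i); split=> // x; apply/gE.
Qed.

Theorem primary_factorsP s : (forall x, span s x) ->
  primary_decomposition M (primary_factors M).
Proof.
move=> sM; have ex := primary_decomposition_span sM.
by rewrite /primary_factors; case: pselect => // ex'; case: cid.
Qed.

End Decomposition.

(** * Laurent polynomials *)

Section LaurentEuclidean.
Variable F : fieldType.
Local Notation L := (laurent F).

Lemma poly_laurentB : zmod_morphism (@poly_laurent F).
Proof. by move=> q r; apply: val_inj; rewrite /= rmorphB. Qed.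

Lemma poly_laurentM : monoid_morphism (@poly_laurent F).
Proof.
by split=> [|q r]; apply: val_inj; rewrite /= ?rmorphM ?rmorph1.
Qed.

HB.instance Definition _ := GRing.isZmodMorphism.Build {poly F} L
  (@poly_laurent F) poly_laurentB.
HB.instance Definition _ := GRing.isMonoidMorphism.Build {poly F} L
  (@poly_laurent F) poly_laurentM.

Lemma laurent_mulf_eq0 (a b : L) : a * b = 0 -> a = 0 \/ b = 0.
Proof.
move=> /(congr1 val)/eqP; rewrite rmorphM rmorph0 mulf_eq0.
by case/orP=> /eqP e; [left|right]; apply: val_inj; rewrite e rmorph0.
Qed.

Lemma laurent_Xinv_subproof n : (tofrac ('X^n : {poly F}))^-1 \in @laurent_pred F.
Proof. by apply/asboolP; exists 1, n; rewrite tofrac1 div1r. Qed.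

Definition laurent_Xinv n : L := Laurent (laurent_Xinv_subproof n).

Lemma laurent_XinvK n : laurent_Xinv n * poly_laurent 'X^n = 1.
Proof. by apply: val_inj; rewrite /= mulVf // tofracXn_neq0. Qed.

Lemma laurentE (x : L) : exists q n, x = laurent_Xinv n * poly_laurent q.
Proof.
have [[q n] e] := laurent_fracP x; exists q, n.
by apply: val_inj; rewrite e /= mulrC.
Qed.

(* The minimum is over the whole ideal generated by [x], which makes the size
   monotone for divisibility at once. *)
Definition laurent_size (x : L) : nat :=
  if pselect (exists n, `[< exists q : {poly F}, [/\ q != 0, divides x (poly_laurent q)
                                         & size q = n] >])
  is left ex then ex_minn ex else 0%N.

Lemma laurent_size_le (x : L) q : q != 0 -> divides x (poly_laurent q) ->
  (laurent_size x <= size q)%N.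
Proof.
move=> q0 xq; rewrite /laurent_size; case: pselect => [ex|[]].
  by case: ex_minnP => m _; apply; apply/asboolP; exists q.
by exists (size q); apply/asboolP; exists q.
Qed.

Lemma laurent_size_attained (x : L) : x != 0 ->
  exists q, [/\ q != 0, divides x (poly_laurent q) & size q = laurent_size x].
Proof.
move=> x0; rewrite /laurent_size; case: pselect => [ex|[]].
  by case: ex_minnP => m /asboolP.
have [q [n e]] := laurentE x; exists (size q); apply/asboolP; exists q; split=> //.
  by apply: contra_neq x0 => q0; rewrite e q0 rmorph0 mulr0.
exists (poly_laurent 'X^n).
by rewrite e mulrA [poly_laurent _ * _]mulrC laurent_XinvK mul1r.
Qed.

(** Up to a power of [t], a unit, [a] is a polynomial. It is divided by a polynomial of least size
    in the ideal of [b]; the remainder is too short to have the size of [b]. *)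
Lemma laurent_euclidean : euclidean laurent_size.
Proof.
split=> [|a b b0 ab|a b b0]; first exact: laurent_mulf_eq0.
  have [q [q0 bq <-]] := laurent_size_attained b0.
  exact: laurent_size_le q0 (divides_trans ab bq).
have [q [q0 [c bq] sq]] := laurent_size_attained b0.
have [pa [n aE]] := laurentE a.
exists (laurent_Xinv n * poly_laurent (pa %/ q) * c).
exists (laurent_Xinv n * poly_laurent (pa %% q)); split.
  rewrite aE {1}(divp_eq pa q) rmorphD rmorphM /= bq; ring.
have [->|r0] := eqVneq (pa %% q) 0; first by left; rewrite rmorph0 mulr0.
right; rewrite -sq; apply: leq_ltn_trans (ltn_modpN0 _ q0).
apply: laurent_size_le r0 _; exists (poly_laurent 'X^n).
by rewrite mulrA [poly_laurent _ * _]mulrC laurent_XinvK mul1r.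
Qed.

End LaurentEuclidean.

(** * The dimension of the space of representations *)

Section PresentedModule.
Variables (R : nzRingType) (I C : finType) (r : C -> {ffun I -> R^o}).

Lemma coker_proj_linear : linear (coker_proj r).
Proof. by move=> a x y; rewrite coker_projD -coker_projZ. Qed.

HB.instance Definition _ := GRing.isLinear.Build R {ffun I -> R^o} (coker r) _
  (coker_proj r) coker_proj_linear.

Lemma ffun_free_gen (v : {ffun I -> R^o}) : v = \sum_i v i *: free_gen R i.
Proof.
apply/ffunP=> j; rewrite sum_ffunE (bigD1 j) //= big1 => [|i ne].
  by rewrite !ffunE eqxx addr0 [LHS](esym (mulr1 _)).
by rewrite !ffunE (negPf ne) scaler0.
Qed.

Lemma module_gen_span (x : presented_module r) :
  exists v : I -> R, x = \sum_i v i *: module_gen r i.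
Proof.
have [v ->] := coker_projK x; exists v.
rewrite {1}(ffun_free_gen v) linear_sum; apply: eq_bigr => i _.
by rewrite linearZ.
Qed.

End PresentedModule.

Lemma span_module_gen (R : comNzRingType) (I C : finType) (r : C -> {ffun I -> R^o})
  (x : presented_module r) : span [seq module_gen r i | i <- enum I] x.
Proof.
have [v ->] := module_gen_span x.
elim/big_rec: _ => [|i y _ sy]; first exact: (submodule_span _).1.
by apply: (submodule_span _).2 => //; apply: mem_span; rewrite map_f // mem_enum.
Qed.

Section LaurentEval.
Variables (F : fieldType) (A : fieldExtType F) (theta : A).
Hypothesis nz : theta != 0.
Local Notation ev := (laurent_eval theta).

Lemma laurent_eval0 : ev 0 = 0.
Proof. by apply: (addrI (ev 0)); rewrite -(laurent_evalD nz) !addr0. Qed.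

Lemma laurent_evalX x n : ev (x ^+ n) = ev x ^+ n.
Proof.
elim: n => [|n IH]; first by rewrite !expr0 (laurent_eval1 nz).
by rewrite !exprS (laurent_evalM nz) IH.
Qed.

Lemma laurent_eval_poly q : ev (poly_laurent q) = horner_alg theta q.
Proof. by rewrite (@laurent_evalE _ _ _ nz _ q 0) ?expr0 ?divr1 //= tofrac1 divr1. Qed.

Variable h : {poly F}.
Hypothesis hE : minPoly 1%VS theta = map_poly (in_alg A) h.

Lemma laurent_eval_minPoly : ev (poly_laurent h) = 0.
Proof.
rewrite laurent_eval_poly; apply/eqP.
by have := root_minPoly 1%VS theta; rewrite hE.
Qed.

(** Since powers of [t] are units, it is enough to treat polynomials, where the kernel of evaluation
    is generated by the minimal polynomial. *)
Lemma laurent_eval_eq0 x : ev x = 0 <-> divides (poly_laurent h) x.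
Proof.
split=> [x0|[c ->]]; last by rewrite (laurent_evalM nz) laurent_eval_minPoly mulr0.
have [q [n xE]] := laurentE x.
have : ev (poly_laurent q) = 0.
  have -> : poly_laurent q = poly_laurent 'X^n * x.
    by rewrite xE mulrA [_ * laurent_Xinv _ _]mulrC laurent_XinvK mul1r.
  by rewrite (laurent_evalM nz) x0 mulr0.
rewrite laurent_eval_poly => /eqP q0.
have : (minPoly 1%VS theta %| map_poly (in_alg A) q)%R.
  apply: minPoly_dvdp => //; apply/polyOverP => i.
  by rewrite coef_map /= rpredZ // mem1v.
rewrite hE dvdp_map => /dvdpP[k qE].
by exists (laurent_Xinv F n * poly_laurent k); rewrite xE qE rmorphM mulrA.
Qed.

(** A prime [q] in the kernel is [c] times the minimal polynomial, so it divides one of the two.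
    Dividing [c] would make the minimal polynomial a unit, although it evaluates to 0. *)
Lemma prime_laurent_eval_eq0 q : prime_elt q ->
  ev q = 0 <-> associates q (poly_laurent h).
Proof.
move=> [q0 qU qP]; split=> [/laurent_eval_eq0 hq|[_ hq]]; last exact/laurent_eval_eq0.
split=> //; have [c qE] := hq.
have /qP[[k cE]|//] : divides q (c * poly_laurent h) by rewrite -qE; exact: divides_refl.
have /(congr1 ev) : 1 = k * poly_laurent h.
  by apply: (euclid_mulIr (laurent_euclidean F) q0); rewrite mul1r {1}qE cE; ring.
rewrite (laurent_evalM nz) laurent_eval_minPoly mulr0 (laurent_eval1 nz).
by move/eqP; rewrite oner_eq0.
Qed.

End LaurentEval.

Lemma card_nth_ord (T : Type) (x0 : T) (s : seq T) (a : pred T) :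
  #|[pred i : 'I_(size s) | a (nth x0 s i)]| = count a s.
Proof.
rewrite cardE /enum_mem size_filter -[in RHS](mkseq_nth x0 s) /mkseq -val_enum_ord.
by rewrite -map_comp count_map enumT; apply: eq_count.
Qed.

Section DecompositionMaps.
Variables (R : comNzRingType) (M : lmodType R) (fs : seq (factor R)).
Local Notation d i := (factor_modulus (nth None fs i)).

(** Universal property of the direct sum. Coordinates are unique only modulo the moduli, which
    suffices for [a i *: n] since [n] is killed by the i-th modulus. *)
Lemma primary_decomposition_maps : primary_decomposition M fs ->
  exists g : 'I_(size fs) -> M,
    [/\ forall x, exists a : 'I_(size fs) -> R, x = \sum_j a j *: g j,
        forall j : 'I_(size fs), d j *: g j = 0
      & forall (N : lmodType R) (i : 'I_(size fs)) (n : N), d i *: n = 0 ->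
          exists f : M -> N,
            linear f /\ forall j : 'I_(size fs), f (g j) = if i == j then n else 0].
Proof.
case=> _ [g [gen rel]]; exists g; split=> // [j|N i n dn].
  have [_ /(_ _)] := rel (fun i => if i == j then d j else 0).
  rewrite (bigD1 j) //= eqxx big1 ?addr0 => [|i /negPf ->]; last by rewrite scale0r.
  apply=> i; case: eqP => [->|_]; first exact: divides_refl.
  by exists 0; rewrite mul0r.
pose F x : N := projT1 (cid (gen x)) i *: n.
have FE a : F (\sum_j a j *: g j) = a i *: n.
  rewrite /F; case: (cid _) => b /= e.
  have /rel/(_ i) [c ab] : \sum_j (b j - a j) *: g j = 0.
    transitivity (\sum_j b j *: g j - \sum_j a j *: g j).
      by rewrite -sumrB; apply: eq_bigr => k _; rewrite scalerBl.
    by rewrite -e subrr.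
  have -> : b i = c * d i + a i by rewrite -ab subrK.
  by rewrite scalerDl -scalerA dn scaler0 add0r.
exists F; split=> [k x y|j].
  have [a xE] := gen x; have [b yE] := gen y.
  have -> : k *: x + y = \sum_j (k * a j + b j) *: g j.
    rewrite xE yE scaler_sumr -big_split /=; apply: eq_bigr => j _.
    by rewrite scalerDl scalerA.
  by rewrite xE yE !FE scalerDl scalerA.
have -> : g j = \sum_k (k == j)%:R *: g k.
  rewrite (bigD1 j) //= eqxx scale1r big1 ?addr0 // => k /negPf ->.
  by rewrite scale0r.
by rewrite FE; case: eqP => _; rewrite ?scale1r ?scale0r.
Qed.

End DecompositionMaps.

Section RepDimension.
Variables (p : nat) (E : fieldExtType 'F_p) (theta : E) (nz : theta != 0).
Variables (D : gauss_diagram) (h : {poly 'F_p}).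
Hypothesis hE : minPoly 1%VS theta = map_poly (in_alg E) h.
Local Notation A := (alexander_module p D).
Local Notation ET := (theta_module nz).
Local Notation Rep := (Rep nz D).
Local Notation fs := (primary_factors A).
Local Notation ev := (laurent_eval theta).

Lemma alexander_decomposition : primary_decomposition A fs.
Proof.
exact: (primary_factorsP (laurent_euclidean _) (span_module_gen (r := @alexander_relation p D))).
Qed.

(* The factors that have a nonzero map to the module E; each of them contributes
   one dimension to [Rep]. *)
Definition visible (x : factor (laurent 'F_p)) : bool :=
  if x is Some (q, _) then `[< associates q (poly_laurent h) >] else true.

Lemma visibleP x : factor_wf x -> reflect (ev (factor_modulus x) = 0) (visible x).
Proof.
case: x => [[q e] [qpr e0]|_] /=; last by left; rewrite (laurent_eval0 nz).
rewrite (laurent_evalX nz); apply: (iffP (asboolP _)).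
  by move/(prime_laurent_eval_eq0 nz hE qpr) ->; rewrite expr0n gtn_eqF.
by move/eqP; rewrite expf_eq0 e0 => /eqP/(prime_laurent_eval_eq0 nz hE qpr).
Qed.

Lemma count_visible : count visible fs = (nu D h + nu_0 p D)%N.
Proof.
rewrite /nu /nu_0 /torsion_count /free_rank.
elim: fs => //= x s ->; case: x => [[q e]|] /=; first by rewrite add0n addnA.
by rewrite add0n addnCA.
Qed.

Lemma rep_evalZ (k : E) (f : Rep) x : (k *: f) x = k * (f x : E) :> E.
Proof. by []. Qed.

Lemma rep_eval_sum (J : finType) (F : J -> Rep) x :
  (\sum_j F j) x = \sum_j F j x :> E.
Proof. by apply: (big_morph (fun f : Rep => f x : E)). Qed.

(** The representations dual to the visible generators form a basis. On the other generators every
    representation vanishes, because their modulus acts on the field E as a nonzero scalar. *)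
Lemma dim_Rep : \dim {:Rep} = (nu D h + nu_0 p D)%N.
Proof.
have [wf _] := alexander_decomposition.
have [g [gen dg ext]] := primary_decomposition_maps alexander_decomposition.
pose good (i : 'I_(size fs)) := visible (nth None fs i).
have bad (f : Rep) j : ~~ good j -> f (g j) = 0.
  move=> /(visibleP (wf j))/eqP nd; have := congr1 f (dg j).
  by rewrite linearZ linear0 => /eqP; rewrite mulf_eq0 (negPf nd) => /eqP.
have rep_ext (f f' : Rep) : (forall j, f (g j) = f' (g j)) -> f = f'.
  move=> e; apply: rep_eqP => x; have [a ->] := gen x.
  by rewrite !linear_sum; apply: eq_bigr => i _; rewrite !linearZ e.
have delta i : good i -> exists f : Rep, forall j, f (g j) = (i == j)%:R.
  move=> /(visibleP (wf i)) di.
  have [|F [Flin FE]] := ext ET i 1; first exact: (etrans (mulr1 _)).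
  by exists (mk_rep Flin) => j; rewrite /= FE; case: eqP.
pose m := #|[pred i | good i]|.
pose idx (k : 'I_m) := @enum_val _ [pred i | good i] k.
have gv k : good (idx k) by exact: (enum_valP k).
pose B k := projT1 (cid (delta _ (gv k))).
have BE k j : B k (g j) = (idx k == j)%:R.
  by rewrite /B; case: (cid _).
pose X := [tuple B k | k < m].
have XE (k : 'I_m) : X`_k = B k by rewrite -tnth_nth tnth_mktuple.
have freeX : free X.
  apply/freeP => c e k.
  have := congr1 (fun f : Rep => f (g (idx k)) : E) e.
  rewrite rep_eval_sum (bigD1 k) //= big1 => [|l lk].
    by rewrite XE ?rep_evalZ BE eqxx mulr1 addr0.
  by rewrite XE ?rep_evalZ BE (inj_eq enum_val_inj) (negPf lk) mulr0n mulr0.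
have spanX : <<X>>%VS = {:Rep}%VS.
  apply/vspaceP => f; rewrite memvf.
  suff -> : f = \sum_k (f (g (idx k)) : E) *: X`_k.
    by apply: rpred_sum => k _; rewrite rpredZ // memv_span // mem_nth // size_tuple.
  apply: rep_ext => j; rewrite rep_eval_sum.
  have [gj|/[dup] ngj /bad ->] := boolP (good j).
    have jA : j \in [pred i | good i] by [].
    rewrite (bigD1 (enum_rank_in jA j)) //= big1 => [|l lj].
      by rewrite XE ?rep_evalZ BE /idx enum_rankK_in // eqxx mulr1 addr0.
    rewrite XE ?rep_evalZ BE; suff /negPf -> : idx l != j by rewrite mulr0n mulr0.
    by apply: contra lj => /eqP e; apply/eqP/enum_val_inj; rewrite enum_rankK_in.
  rewrite big1 // => l _; rewrite XE ?rep_evalZ BE.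
  suff /negPf -> : idx l != j by rewrite mulr0n mulr0.
  by apply: contra ngj => /eqP <-.
by rewrite -spanX (eqP freeX) size_tuple -count_visible -(card_nth_ord None).
Qed.

End RepDimension.

(** * Value distribution of Hermitian forms over a quadratic extension *)

Section QuadraticExtension.
Variables (p : nat) (p_prime : prime p) (K : finFieldType).
Hypothesis cardK : #|K| = (p ^ 2)%N.
Variable io : {rmorphism 'F_p -> K}.

Lemma frobeniusD (x y : K) : (x + y) ^+ p = x ^+ p + y ^+ p.
Proof. exact: rmorphD (pFrobenius_aut (card_finPcharP cardK p_prime)) x y. Qed.

Lemma frobeniusK (x : K) : x ^+ p ^+ p = x.
Proof. by rewrite -exprM mulnn -cardK expf_card. Qed.

Lemma card_roots_le (q : {poly K}) : q != 0 ->
  (#|[set x | root q x]| <= (size q).-1)%N.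
Proof.
move=> q0; have := max_poly_roots (rs := enum [set x | root q x]) q0.
rewrite enum_uniq -cardE => /(_ _ isT) lt_q.
have : (#|[set x | root q x]| < size q)%N.
  by apply: lt_q; apply/allP => x; rewrite mem_enum inE.
by case: (size q).
Qed.

Lemma frobenius_fixed (x : K) : x ^+ p = x -> exists a, x = io a.
Proof.
move=> xp; pose q : {poly K} := 'X^p - 'X.
have sq : size q = p.+1.
  by rewrite size_polyDl size_polyXn // size_polyN size_polyX ltnS prime_gt1.
have q0 : q != 0 by rewrite -size_poly_eq0 sq.
have rootq y : root q y = (y ^+ p == y).
  by rewrite rootE !hornerE subr_eq0.
have : [set io a | a : 'F_p] == [set y | root q y].
  rewrite eqEcard; apply/andP; split.
    apply/subsetP=> _ /imsetP[a _ ->].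
    by rewrite inE rootq -rmorphXn -[X in a ^+ X](card_Fp p_prime) expf_card.
  rewrite card_imset ?card_Fp //; last exact: fmorph_inj.
  by have := card_roots_le q0; rewrite sq.
move/eqP/setP/(_ x); rewrite inE rootq xp eqxx => /imsetP[a _ ->].
by exists a.
Qed.

Definition norm_Fp (x : K) : 'F_p := odflt 0 [pick a | io a == x ^+ p.+1].

Lemma norm_FpE x : io (norm_Fp x) = x ^+ p.+1.
Proof.
rewrite /norm_Fp; case: pickP => [a /eqP //|no].
have [|a xE] := @frobenius_fixed (x ^+ p.+1).
  by rewrite exprS exprMn frobeniusK mulrC.
by have := no a; rewrite xE eqxx.
Qed.

Lemma norm_Fp_eq0 x : (norm_Fp x == 0) = (x == 0).
Proof. by rewrite -(fmorph_eq0 io) norm_FpE expf_eq0. Qed.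

(** A fiber consists of roots of a polynomial of degree p + 1, and p - 1 fibers share the p^2 - 1
    nonzero elements, so each bound is attained. *)
Lemma card_norm_fiber a : a != 0 -> #|[set x | norm_Fp x == a]| = p.+1.
Proof.
have le_fiber b : b != 0 -> (#|[set x | norm_Fp x == b]| <= p.+1)%N.
  move=> _; pose q : {poly K} := 'X^(p.+1) - (io b)%:P.
  have sq : size q = p.+2 by rewrite size_XnsubC.
  have q0 : q != 0 by rewrite -size_poly_eq0 sq.
  have := card_roots_le q0; rewrite sq; apply: leq_trans; apply: subset_leq_card.
  apply/subsetP => x; rewrite !inE => /eqP xb.
  by rewrite /q rootE !hornerE -xb norm_FpE subrr.
have sumE : (\sum_(b : 'F_p | b != 0%R) #|[set x | norm_Fp x == b]|
             = \sum_(b : 'F_p | b != 0%R) p.+1)%N.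
  rewrite sum_nat_const.
  have -> : #|(fun b : 'F_p => b != 0)| = p.-1.
    by transitivity #|predC1 (0 : 'F_p)|; [exact: eq_card | rewrite cardC1 card_Fp].
  transitivity (\sum_(x : K | x != 0%R) 1)%N; last first.
    rewrite sum1_card -(@eq_card _ (predC1 0)) // cardC1 cardK.
    by have := prime_gt0 p_prime; case: (p) => // n _; rewrite expnS expn1; lia.
  rewrite (partition_big norm_Fp (fun b => b != 0)) /= => [|x]; last first.
    by rewrite norm_Fp_eq0.
  apply: eq_bigr => b b0; rewrite -sum1_card; apply: eq_bigl => x.
  rewrite inE; case: eqP => [e|]; rewrite ?andbF // andbT.
  by rewrite -norm_Fp_eq0 e b0.
move=> a0; have := leqif_sum (fun b b0 => leqif_eq (le_fiber b b0)).
by rewrite sumE => -[_ /esym]; rewrite eqxx => /forall_inP/(_ a a0)/eqP.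
Qed.

Lemma norm_Fp_surj a : a != 0 -> exists2 k, k != 0 & norm_Fp k = a.
Proof.
move=> a0; have : (0 < #|[set x | norm_Fp x == a]|)%N by rewrite card_norm_fiber.
case/card_gt0P => k; rewrite inE => /eqP kE; exists k => //.
by rewrite -norm_Fp_eq0 kE.
Qed.

(** The trace polynomial has at most p roots, fewer than p^2. Counting also covers p = 2, where 1
    has trace 0. *)
Lemma trace_neq0 : exists m : K, m + m ^+ p != 0.
Proof.
pose q : {poly K} := 'X^p + 'X.
have sq : size q = p.+1.
  by rewrite size_polyDl size_polyXn // size_polyX ltnS prime_gt1.
have q0 : q != 0 by rewrite -size_poly_eq0 sq.
case: (pickP [pred m : K | m + m ^+ p != 0]) => [m mP|no]; first by exists m.
have := card_roots_le q0; rewrite sq /= leqNgt => /negP[].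
have -> : [set x | root q x] = setT.
  apply/setP => x; rewrite !inE rootE !hornerE addrC.
  by have /negbFE := no x.
by rewrite cardsT cardK -[ltnLHS]expn1 ltn_exp2l // prime_gt1.
Qed.

Section HermitianForm.
Variables (V : finLmodType K) (h : V -> V -> K) (B : V -> 'F_p).
Hypothesis hD : forall x y z, h (x + y) z = h x z + h y z.
Hypothesis hZ : forall k x y, h (k *: x) y = k * h x y.
Hypothesis hC : forall x y, h y x = h x y ^+ p.
Hypothesis BE : forall x, io (B x) = h x x.

Let hDr x y z : h x (y + z) = h x y + h x z.
Proof. by rewrite hC hD frobeniusD -!hC. Qed.

Let hZr k x y : h x (k *: y) = k ^+ p * h x y.
Proof. by rewrite hC hZ exprMn -hC. Qed.

Let h0 x : h 0 x = 0.
Proof. by rewrite -(scale0r 0) hZ mul0r. Qed.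

Lemma hermitian_scale k x : B (k *: x) = norm_Fp k * B x.
Proof.
by apply: (fmorph_inj io); rewrite rmorphM norm_FpE !BE hZ hZr mulrA exprS.
Qed.

Local Notation level a := #|[set x | B x == a]|.

Lemma card_level a : a != 0 -> level a = level 1.
Proof.
move=> a0; have [k k0 ka] := norm_Fp_surj a0.
rewrite -[RHS](card_imset _ (scalerI k0)); apply: eq_card => x.
rewrite inE; apply/eqP/imsetP => [Bx|[y]]; last first.
  by rewrite inE => /eqP By ->; rewrite hermitian_scale By mulr1.
exists (k^-1 *: x); last by rewrite scalerA divff // scale1r.
rewrite inE; apply/eqP/(mulfI a0); rewrite mulr1 -{1}ka -hermitian_scale.
by rewrite scalerA divff // scale1r.
Qed.

(* The norm-one group acts freely on the vectors of value 1. *)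
Lemma dvdn_card_level1 : (p.+1 %| level 1%R)%N.
Proof.
pose U := [set k : K | norm_Fp k == 1].
have U0 (k : K) : k \in U -> k != 0.
  by rewrite inE -norm_Fp_eq0 => /eqP ->; rewrite oner_neq0.
have normM (k l : K) : norm_Fp (k * l) = norm_Fp k * norm_Fp l.
  by apply: (fmorph_inj io); rewrite rmorphM !norm_FpE exprMn.
have U1 : (1 : K) \in U.
  by rewrite inE; apply/eqP/(fmorph_inj io); rewrite norm_FpE expr1n rmorph1.
have UM (k l : K) : k \in U -> l \in U -> k * l \in U.
  by rewrite !inE normM => /eqP -> /eqP ->; rewrite mulr1.
have UV (k : K) : k \in U -> k^-1 \in U.
  move=> Uk; have k0 := U0 k Uk; move: Uk U1; rewrite !inE => /eqP Uk.
  by rewrite -(divff k0) normM Uk mul1r.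
pose S := [set x | B x == 1].
pose R (x y : V) := [exists k : K in U, y == k *: x].
have RP (x y : V) : reflect (exists2 k : K, k \in U & y = k *: x) (R x y).
  by apply: (iffP exists_inP) => -[k Uk e]; exists k => //; apply/eqP.
have eqR : {in S & &, equivalence_rel R}.
  move=> x y z _ _ _; split; first by apply/RP; exists (1 : K); rewrite ?scale1r.
  move=> /RP[k Uk ->]; apply/RP/RP => -[l Ul ->].
    exists (l * k^-1); first by rewrite UM ?UV.
    by rewrite scalerA -mulrA mulVf ?U0 // mulr1.
  by exists (l * k); rewrite ?UM // scalerA.
rewrite -/S (card_uniform_partition (n := p.+1) _ (equivalence_partitionP eqR)).
  exact: dvdn_mull.
move=> _ /imsetP[x Sx ->].
have x0 : x != 0.
  apply: contraTneq Sx => ->; rewrite inE -(inj_eq (fmorph_inj io)) BE h0.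
  by rewrite rmorph1 eq_sym oner_neq0.
rewrite -(card_norm_fiber (oner_neq0 _)) -/U.
rewrite -(card_imset _ (_ : injective (fun k : K => k *: x))).
  apply: eq_card => y; rewrite inE; apply/andP/imsetP => [[_ /RP[k Uk ->]]|[k Uk ->]].
    by exists k.
  split; last by apply/RP; exists k.
  by move: Sx Uk; rewrite !inE hermitian_scale => /eqP -> /eqP ->; rewrite mulr1.
move=> k l e; apply/eqP; rewrite -subr_eq0; apply: contraNT x0 => kl.
by rewrite -(inj_eq (scalerI kl)) scaler0 scalerBl subr_eq0 e.
Qed.

Definition radical_set := [set x | [forall y, h x y == 0]].

(* A Gauss sum: its square is computed by completing the square. *)
Lemma sqr_level_diff :
  ((level 0)%:Z - (level 1)%:Z) ^+ 2 = (#|V| * #|radical_set|)%N%:Z.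
Proof.
have [z zprim] := C_prim_root_exists (prime_gt0 p_prime).
pose psi (a : 'F_p) : algC := z ^+ a.
have psiD a b : psi (a + b) = psi a * psi b.
  have abE : nat_of_ord (a + b) = ((a + b) %% p)%N.
    exact: (congr1 (modn (a + b)%N) (Fp_cast p_prime)).
  by rewrite /psi -exprD abE (prim_expr_mod zprim).
have psi0 : psi 0 = 1 by rewrite /psi expr0.
have psi_eq1 a : psi a = 1 -> a = 0.
  move/eqP; rewrite -(prim_order_dvd zprim) => pa; apply/val_inj => /=.
  have lt_ap : (a < p)%N by rewrite -[ltnRHS](Fp_cast p_prime) ltn_ord.
  by move: pa; rewrite /dvdn modn_small // => /eqP.
have sum0 (W : finZmodType) (T : W -> 'F_p) y0 :
    (forall x y, T (x + y) = T x + T y) -> T y0 != 0 -> \sum_y psi (T y) = 0.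
  move=> TD Ty0; apply/eqP; have : (1 - psi (T y0)) * \sum_y psi (T y) == 0.
    rewrite mulrBl mul1r subr_eq0 mulr_sumr {1}(reindex_inj (addrI y0)) /=.
    by apply/eqP/eq_bigr => y _; rewrite TD psiD.
  rewrite mulf_eq0 subr_eq0 => /orP[/eqP/esym/psi_eq1 e|//].
  by rewrite e eqxx in Ty0.
(* The nonzero values are equally frequent and [chi] sums to -1 over them. *)
have levelE (chi : 'F_p -> algC) : chi 0 = 1 -> \sum_a chi a = 0 ->
    \sum_x chi (B x) = (level 0)%:R - (level 1)%:R.
  move=> chi0 chi_sum; rewrite (partition_big B xpredT) //=.
  have fiberE a : \sum_(x | B x == a) chi (B x) = chi a *+ level a.
    rewrite -sumr_const; under eq_bigr => x /eqP -> do [].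
    by apply: eq_bigl => x; rewrite inE.
  under eq_bigr => a _ do rewrite fiberE.
  rewrite (bigD1 0) //= chi0; congr (_ + _).
  under eq_bigr => a a0 do rewrite card_level //.
  rewrite sumrMnl; move: chi_sum; rewrite (bigD1 0) //= chi0.
  by move/eqP; rewrite addrC addr_eq0 => /eqP ->; rewrite mulNrn.
(* The polarization of [B], which is the trace of [h z y]. *)
pose T z y := B (z + y) - B z - B y.
have TE w y : io (T w y) = h w y + h y w.
  by rewrite /T !rmorphB !BE hD !hDr; ring.
have TD w x y : T w (x + y) = T w x + T w y.
  by apply: (fmorph_inj io); rewrite [RHS]rmorphD /= !TE hDr hD; ring.
have sum1 : \sum_x psi (B x) = (level 0)%:R - (level 1)%:R.
  by apply: levelE => //; apply: (@sum0 'F_p id 1); rewrite ?oner_neq0.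
have sum2 : \sum_x psi (- B x) = (level 0)%:R - (level 1)%:R.
  apply: (levelE (fun a => psi (- a))); first by rewrite oppr0.
  by apply: (@sum0 'F_p -%R 1) => [x y|]; rewrite ?opprD ?oppr_eq0 ?oner_neq0.
have inner w : \sum_y psi (T w y) = (w \in radical_set)%:R * #|V|%:R.
  rewrite inE; case: forallP => [rw0|nrw0].
    rewrite mul1r -sum1_card natr_sum; apply: eq_bigr => y _.
    suff -> : T w y = 0 by rewrite psi0.
    apply/eqP; rewrite -(fmorph_eq0 io) TE [h y w]hC; have /eqP -> := rw0 y.
    by rewrite expr0n gtn_eqF ?prime_gt0 // addr0.
  rewrite mul0r; have [y1 hy1] : exists y, h w y != 0.
    apply/existsP; apply: contraPT nrw0; rewrite negb_exists => /forallP e; apply.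
    by move=> y; have /negbNE := e y.
  have [m m0] := trace_neq0.
  (* Semilinearity raises the scalar to the p-th power once more, so [h w] takes the value [m] at
     this vector, and [T w] the nonzero trace of [m]. *)
  apply: (sum0 _ _ ((m / h w y1) ^+ p *: y1)) => //.
  rewrite -(fmorph_eq0 io) TE [h _ w]hC hZr frobeniusK.
  by rewrite -mulrA mulVf // mulr1.
apply: (@intr_inj algC); rewrite rmorphXn rmorphB /= -!pmulrn.
(* One factor is written with the conjugate character. Replacing [x] by [x + y] turns the exponent
   into [B x + T x y], and the sum over [y] keeps only [x] in the radical, where [B] vanishes. *)
rewrite expr2 -{1}sum1 -sum2 mulr_suml.
under eq_bigr => x _ do (rewrite mulr_sumr; under eq_bigr => y _ do rewrite -psiD).
rewrite exchange_big /=.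
under eq_bigr => y _ do rewrite (reindex_inj (addIr y)) /=.
rewrite exchange_big /=.
under eq_bigr => x _.
  under eq_bigr => y _.
    have -> : B (x + y) - B y = B x + T x y by rewrite /T; ring.
    rewrite psiD; over.
  rewrite -mulr_sumr inner; over.
rewrite natrM mulrC -[in RHS]sum1_card natr_sum mulr_suml [RHS]big_mkcond /=.
apply: eq_bigr => x _; case: ifP => [|_]; last by rewrite mul0r mulr0.
rewrite inE => /forallP/(_ x)/eqP hx.
have -> : B x = 0 by apply/eqP; rewrite -(fmorph_eq0 io) BE hx.
by rewrite psi0 mul1r.
Qed.

Lemma sum_level : (#|V| = level 0%R + p.-1 * level 1%R)%N.
Proof.
rewrite -[LHS]sum1_card (partition_big B xpredT) //=.
have fiberE a : (\sum_(x | B x == a) 1 = level a)%N.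
  by rewrite sum1_card; apply: eq_card => x; rewrite inE.
under eq_bigr => a _ do rewrite fiberE.
rewrite (bigD1 0%R) //=; congr (_ + _)%N.
under eq_bigr => a a0 do rewrite card_level //.
rewrite sum_nat_const; congr (_ * _)%N.
by transitivity #|predC1 (0 : 'F_p)|; [exact: eq_card | rewrite cardC1 card_Fp].
Qed.

(* The square fixes the difference up to sign; the sign is read modulo p + 1. *)
Lemma level_diff n s : (s <= n)%N ->
  #|V| = (p ^ (2 * n))%N -> #|radical_set| = (p ^ (2 * s))%N ->
  (level 0)%:Z - (level 1)%:Z = (- p%:Z) ^+ (n - s) * (p ^ (2 * s))%N%:Z.
Proof.
move=> le_sn cV cR; set d := LHS; set t := RHS.
have p0 := prime_gt0 p_prime.
have pX k : (p ^ k)%N%:Z = p%:Z ^+ k.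
  by elim: k => // k IH; rewrite expnS exprS PoszM IH.
have : d ^+ 2 == t ^+ 2.
  rewrite /d /t sqr_level_diff cV cR exprMn [_ ^+ (n - s) ^+ 2]exprAC sqrrN.
  rewrite PoszM !pX -!exprM -!exprD; apply/eqP; congr (_ ^+ _); lia.
rewrite eqf_sqr => /orP[/eqP //|/eqP dt].
(* Modulo p + 1 one has p = -1, so [d] and [t] both reduce to 1. The case [d = - t] would then give
   2 = 0, while p + 1 > 2. *)
pose f (a : int) : 'Z_p.+1 := a%:~R.
have p1 : p%:R = - 1 :> 'Z_p.+1.
  apply/eqP; rewrite -addr_eq0 natr1; apply/eqP.
  by apply: pchar_Zp; rewrite ltnS.
have p2 k : (p ^ (2 * k))%:R = 1 :> 'Z_p.+1.
  by rewrite natrX p1 exprM sqrrN !expr1n.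
have l1 : (level 1)%:R = 0 :> 'Z_p.+1.
  have /dvdnP[c ->] := dvdn_card_level1.
  by rewrite natrM pchar_Zp ?mulr0 // ltnS.
have fd : f d = 1.
  rewrite /f /d rmorphB /= -!pmulrn l1 subr0.
  transitivity (#|V|%:R : 'Z_p.+1); last by rewrite cV p2.
  by rewrite sum_level natrD natrM l1 mulr0 addr0.
have ft : f t = 1.
  by rewrite /f /t rmorphM rmorphXn rmorphN /= -!pmulrn p1 opprK expr1n p2 mulr1.
have : (2%:R : 'Z_p.+1) = 0.
  by rewrite mulr2n -{1}fd dt /f rmorphN /= -/(f t) ft addNr.
have := @val_Zp_nat p.+1 _ 2; rewrite ltnS p0 modn_small ?ltnS ?prime_gt1 //.
by move=> /(_ isT) + e; rewrite e.
Qed.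

End HermitianForm.
End QuadraticExtension.

(** * Powers of Gamma in the group ring *)

Section GroupRingPowers.
Variables (p : nat) (p_prime : prime p) (gT : finGroupType) (u : gT).
Hypotheses (card_gT : #|gT| = p) (u_gen : <[u]>%g = [set: gT]).
Local Notation ZG := (group_ring gT).

Lemma gr_eltM (x y : gT) : gr_elt x * gr_elt y = gr_elt (x * y)%g :> ZG.
Proof.
apply/ffunP => z; rewrite !ffunE (bigD1 x) //= big1 => [|w xw].
  by rewrite !ffunE eqxx mul1r addr0 -(inj_eq (mulgI x)) mulKVg.
by rewrite ffunE eq_sym (negPf xw) mul0r.
Qed.

Definition gr_norm : ZG := \sum_(x : gT) gr_elt x.

Lemma gr_normM : gr_norm * gr_norm = gr_norm *+ p.
Proof.
rewrite {1}/gr_norm mulr_suml -card_gT -sumr_const; apply: eq_bigr => x _.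
rewrite /gr_norm mulr_sumr [RHS](reindex_inj (mulgI x)) /=.
by apply: eq_bigr => y _; rewrite gr_eltM.
Qed.

Lemma order_gen : #[u]%g = p.
Proof. by rewrite /order u_gen cardsT. Qed.

Lemma gr_norm_Fp : gr_norm = \sum_(a : 'F_p) gr_elt (u ^+ a)%g.
Proof.
have inj_u : injective (fun a : 'F_p => u ^+ a)%g.
  move=> a b /eqP; rewrite eq_expg_mod_order order_gen.
  have lt_p (c : 'F_p) : (c < p)%N by rewrite -[ltnRHS](Fp_cast p_prime) ltn_ord.
  by rewrite !modn_small // => /eqP/val_inj.
rewrite /gr_norm (reindex (fun a : 'F_p => u ^+ a)%g) //=.
by apply/onW_bij/inj_card_bij => //; rewrite card_gT card_Fp.
Qed.

Lemma gr_norm_cyclic : gr_norm = 1 + \sum_(1 <= i < p) gr_elt (u ^+ i)%g.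
Proof.
rewrite gr_norm_Fp -(big_mkord xpredT (fun i => gr_elt (u ^+ i)%g)).
by rewrite Fp_cast // big_ltn ?prime_gt0 // expg0.
Qed.

Lemma sum_gr_elt (V : finType) (B : V -> 'F_p) (n0 n1 : nat) :
  #|[set x | B x == 0]| = n0 ->
  (forall a, a != 0 -> #|[set x | B x == a]| = n1) ->
  \sum_x gr_elt (u ^+ B x)%g = 1 *+ n0 + (gr_norm - 1) *+ n1 :> ZG.
Proof.
move=> e0 e1; rewrite (partition_big B xpredT) //=.
have fiberE a : \sum_(x | B x == a) gr_elt (u ^+ B x)%g
    = gr_elt (u ^+ a)%g *+ #|[set x | B x == a]| :> ZG.
  rewrite -sumr_const; under eq_bigr => x /eqP -> do [].
  by apply: eq_bigl => x; rewrite inE.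
under eq_bigr => a _ do rewrite fiberE.
rewrite (bigD1 0) //= e0 expg0; congr (_ + _).
under eq_bigr => a a0 do rewrite e1 //.
by rewrite sumrMnl gr_norm_Fp [in RHS](bigD1 0) //= expg0 [1 + _]addrC addrK.
Qed.

(** The second equation compares augmentations: [Gamma] has augmentation p^2 and [gr_norm] has p. It
    determines [g] without a division in the integers. *)
Lemma Gamma_exp r : exists2 g : int,
  Gamma p u ^+ r = 1 *~ ((- p%:Z) ^+ r) + gr_norm *~ g
  & p%:Z * g = p%:Z ^+ (2 * r) - (- p%:Z) ^+ r.
Proof.
have GammaE : Gamma p u = gr_norm *~ p.+1%:Z - 1 *~ p%:Z.
  rewrite /Gamma -(addrK 1 (\sum_(1 <= i < p) _)) [_ + 1]addrC -gr_norm_cyclic.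
  rewrite mulrBr mulr1 mulr_natl -!pmulrn addrCA; congr (_ + _).
  by rewrite [1 *+ p.+1]mulrS opprD addrA subrr add0r.
elim: r => [|r [g GE gE]]; first by exists 0; rewrite ?mulr0 ?subrr // mulr0z addr0.
exists ((- p%:Z) ^+ r * p.+1%:Z + g * p%:Z ^+ 2).
  rewrite exprSr GE GammaE mulrBr !mulrDl !mulrzAl !mulrzAr !mul1r !mulr1.
  rewrite gr_normM pmulrn -!mulrzA.
  rewrite opprD addrCA -mulrNz -mulrzDr -mulrzBr.
  congr (_ *~ _ + _ *~ _); first by rewrite exprS mulNr.
  rewrite -addn1 PoszD; ring.
rewrite mulnS exprD [(- _) ^+ r.+1]exprS -addn1 PoszD.
set A := (- p%:Z) ^+ r in gE *.
have -> : p%:Z * (A * (p%:Z + 1%:Z) + g * p%:Z ^+ 2)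
   = p%:Z * g * p%:Z ^+ 2 + A * p%:Z * (p%:Z + 1) by ring.
rewrite gE; ring.
Qed.

(** Subtracting the two hypotheses gives [p * n1], hence [n1] as the coefficient of [gr_norm], while
    [n0 - n1] is the coefficient of 1. *)
Lemma Gamma_expE r s n0 n1 :
  n0%:Z - n1%:Z = (- p%:Z) ^+ r * (p ^ (2 * s))%N%:Z ->
  (n0 + p.-1 * n1 = p ^ (2 * (r + s)))%N ->
  1 *+ n0 + (gr_norm - 1) *+ n1 = Gamma p u ^+ r * (p ^ (2 * s))%:R.
Proof.
move=> d01 sum01; have [g -> gE] := Gamma_exp r.
have pX k : (p ^ k)%N%:Z = p%:Z ^+ k.
  by elim: k => // k IH; rewrite expnS exprS PoszM IH.
have n1E : n1%:Z = g * (p ^ (2 * s))%N%:Z.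
  have p0 : p%:Z != 0 by rewrite eqz_nat -lt0n prime_gt0.
  apply: (mulfI p0); rewrite mulrA gE mulrBl -d01 pX -exprD -mulnDr -pX -sum01.
  rewrite PoszD PoszM; have -> : p%:Z = p.-1%:Z + 1.
    by rewrite -{1}(prednK (prime_gt0 p_prime)) -addn1 PoszD.
  ring.
rewrite mulr_natr !mulrnDl mulNrn addrCA [RHS]addrC !pmulrn.
by congr (_ + _); rewrite -?mulrzBr -mulrzA ?d01 ?n1E.
Qed.

End GroupRingPowers.

(** * The Hermitian form of a diagram *)

Section PresentedModuleMaps.
Variables (R : nzRingType) (I C : finType) (r : C -> {ffun I -> R^o}).

Lemma sum_free_gen (M : lmodType R) (g : I -> M) j :
  \sum_i free_gen R j i *: g i = g j.
Proof.
rewrite (bigD1 j) //= big1 => [|i ne]; first by rewrite ffunE eqxx scale1r addr0.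
by rewrite ffunE eq_sym (negPf ne) scale0r.
Qed.

Lemma sum_free_gen_relation (M : lmodType R) (g : I -> M) j k l (a b : R) :
  \sum_i (free_gen R j - (a *: free_gen R k + b *: free_gen R l)) i *: g i =
  g j - (a *: g k + b *: g l).
Proof.
rewrite -!(sum_free_gen g) !scaler_sumr -big_split -sumrB /=.
by apply: eq_bigr => i _; rewrite !ffunE scalerBl scalerDl !scalerA.
Qed.

Lemma module_gen_relation c : \sum_i r c i *: module_gen r i = 0.
Proof.
transitivity (coker_proj r (r c)).
  rewrite [in RHS](ffun_free_gen (r c)) linear_sum.
  by apply: eq_bigr => i _; rewrite linearZ.
rewrite -(linear0 (coker_proj r)); apply/eqP; rewrite coker_projE subr0.
apply/asboolP; exists (fun d => (d == c)%:R); rewrite (bigD1 c) //= eqxx scale1r.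
by rewrite big1 ?addr0 // => d /negPf ->; rewrite scale0r.
Qed.

Lemma presented_module_map (M : lmodType R) (g : I -> M) :
  (forall c, \sum_i r c i *: g i = 0) ->
  exists f : presented_module r -> M,
    linear f /\ forall i, f (module_gen r i) = g i.
Proof.
move=> gr; pose L (v : {ffun I -> R^o}) : M := \sum_i v i *: g i.
have Llin : linear L.
  move=> a v w; rewrite /L scaler_sumr -big_split /=; apply: eq_bigr => i _.
  by rewrite !ffunE scalerDl scalerA.
pose LL : {linear {ffun I -> R^o} -> M} :=
  HB.pack L (GRing.isLinear.Build _ _ _ _ L Llin).
have Lr v : v \in span_pred r -> L v = 0.
  move=> /asboolP[a ->]; rewrite (linear_sum LL _ _ _ : L _ = _) big1 // => c _.
  by rewrite linearZ /= /L gr scaler0.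
pose f x := L (projT1 (cid (coker_projK (x : coker r)))).
have fE v : f (coker_proj r v) = L v.
  rewrite /f; case: (cid _) => w /= /esym/eqP; rewrite coker_projE => /Lr.
  by rewrite (linearB LL w v : L _ = L w - L v) => /subr0_eq.
exists f; split=> [a x y|i]; last by rewrite fE /L sum_free_gen.
have [v ->] := coker_projK x; have [w ->] := coker_projK y.
by rewrite -linearP !fE Llin.
Qed.

End PresentedModuleMaps.

Lemma linear_comb (R : pzRingType) (M N : lmodType R) (f : {linear M -> N})
    a b (x y z : M) : x = a *: y + b *: z -> f x = a *: f y + b *: f z.
Proof. by move=> ->; rewrite linearD !linearZ. Qed.

Section ArcRelations.
Variables (p : nat) (D : gauss_diagram).
Local Notation Lambda := (laurent 'F_p).
Local Notation t := (laurent_t 'F_p).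

Lemma alexander_relation_sum (M : lmodType Lambda) (g : arc D -> M) c :
  \sum_a alexander_relation p c a *: g a =
  g (left_arc c) - (t *: g (right_arc c) + (1 - t) *: g (over_arc c)).
Proof.
exact: sum_free_gen_relation.
Qed.

Lemma arc_gen_relation (c : crossing D) :
  arc_gen p (left_arc c) =
  t *: arc_gen p (right_arc c) + (1 - t) *: arc_gen p (over_arc c).
Proof.
apply/eqP; rewrite -subr_eq0 -alexander_relation_sum; apply/eqP.
exact: module_gen_relation.
Qed.

Lemma arc_of_prev (c : crossing D) : arc_of (prev_passage (c, true)) = arc_of (c, true) :> arc D.
Proof.
congr inl; apply: val_inj => /=; apply/setP => y; rewrite !inE.
have sym : connect_sym (@over_joined D).
  by apply: sym_connect_sym => x z; rewrite /over_joined orbC.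
apply: (same_connect sym); apply: connect1.
by rewrite /over_joined /prev_passage permKV eqxx.
Qed.

(** Summed over all passages the differences cancel, as the passages are permuted; an overpassage
    contributes nothing since it does not change the arc. *)
Lemma sum_under_arcs (V : zmodType) (F : arc D -> V) :
  \sum_(c : crossing D) (F (under_out c) - F (under_in c)) = 0.
Proof.
have sum0 : \sum_(x : passage D) (F (arc_of x) - F (arc_of (prev_passage x))) = 0.
  rewrite sumrB [X in X - _](reindex_inj (perm_inj (s := (next_passage D)^-1%g))).
  by rewrite subrr.
rewrite -[RHS]sum0; transitivity (\sum_(c : crossing D) \sum_(b : bool)
    (F (arc_of (c, b)) - F (arc_of (prev_passage (c, b))))).
  by apply: eq_bigr => c _; rewrite big_bool /= arc_of_prev subrr add0r.
by rewrite pair_bigA; apply: eq_bigr => -[c b] _.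
Qed.

End ArcRelations.

Lemma link_has_arc (D : link_diagram) : inhabited (arc D).
Proof.
have := link_nonempty D; rewrite addn_gt0 => /orP[/card_gt0P[c _]|circ].
  by split; exact: over_arc c.
by split; exact: inr (Ordinal circ).
Qed.

Section EtaForm.
Variables (p : nat) (p_prime : prime p) (E : fieldExtType 'F_p).
Hypothesis dimE : \dim {:E} = 2%N.
Variables (theta : E) (nz : theta != 0) (ii : E).
Hypothesis ii_conj : conj ii = - ii.
Variable D : gauss_diagram.
Local Notation Rep := (Rep nz D).
Local Notation eta := (@eta p E theta nz ii D).

Lemma card_E : #|finvect_type E| = (p ^ 2)%N.
Proof.
have <- : #|{: finvect_type E}%VS| = #|finvect_type E|.
  by apply: eq_card => x; rewrite memvf.
by rewrite card_vspace card_Fp // dimE.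
Qed.

Lemma conjD (x y : E) : conj (x + y) = conj x + conj y.
Proof. exact: (frobeniusD p_prime card_E). Qed.

Lemma conjM (x y : E) : conj (x * y) = conj x * conj y.
Proof. exact: exprMn. Qed.

Lemma conjK (x : E) : conj (conj x) = x.
Proof. exact: (frobeniusK card_E). Qed.

Lemma conj0 : conj 0 = 0 :> E.
Proof. by rewrite /conj expr0n gtn_eqF ?prime_gt0. Qed.

Lemma conj1 : conj 1 = 1 :> E.
Proof. exact: expr1n. Qed.

Lemma conjN (x : E) : conj (- x) = - conj x.
Proof. by apply/eqP; rewrite -addr_eq0 -conjD addNr conj0. Qed.

Lemma conj_sum (J : Type) (s : seq J) (F : J -> E) :
  conj (\sum_(j <- s) F j) = \sum_(j <- s) conj (F j).
Proof. exact: (big_morph _ conjD conj0). Qed.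

Lemma conj_sign (c : crossing D) : conj (sign E c) = sign E c.
Proof. by rewrite /sign; case: positive; rewrite ?conjN conj1. Qed.

Lemma rep_atD (f g : Rep) a : rep_at (f + g) a = rep_at f a + rep_at g a.
Proof. by []. Qed.

Lemma rep_atZ k (f : Rep) a : rep_at (k *: f) a = k * rep_at f a.
Proof. by []. Qed.

Lemma etaD f g e : eta (f + g) e = eta f e + eta g e.
Proof.
by rewrite /Defs.eta -big_split; apply: eq_bigr => c _; rewrite !rep_atD [RHS]/=; ring.
Qed.

Lemma etaZ k f g : eta (k *: f) g = k * eta f g.
Proof.
by rewrite /Defs.eta mulr_sumr; apply: eq_bigr => c _; rewrite !rep_atZ; ring.
Qed.

Lemma eta_conj f g : eta g f = conj (eta f g).
Proof.
rewrite /Defs.eta conj_sum; apply: eq_bigr => c _.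
rewrite !conjM conj_sign ii_conj conjD conjN !conjM !conjK; ring.
Qed.

(** The value is fixed by conjugation, hence lies in F_p, and the default of [to_Fp] is never
    taken. *)
Lemma phi_eta x y : (phi ii x y)%:A = ii * (x * conj y - conj x * y).
Proof.
set z := RHS; have zc : conj z = z.
  by rewrite /z conjM ii_conj conjD conjN !conjM !conjK; ring.
have [a za] : exists a, z = a%:A :> E.
  exact: (@frobenius_fixed p p_prime (finvect_type E) (in_alg (finvect_type E)) z zc).
rewrite /phi -/z /to_Fp; case: pickP => [b /eqP //|no].
by have := no a; rewrite za eqxx.
Qed.

Lemma boltzmann_eta f : (boltzmann_weight ii f)%:A = eta f f.
Proof.
rewrite -[LHS]/(in_alg E _) rmorph_sum; apply: eq_bigr => c _.
rewrite rmorphM /= phi_eta; congr (_ * (_ * (_ - _))); last exact: mulrC.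
by rewrite /sign; case: positive; rewrite ?scaleNr scale1r.
Qed.

Lemma rep_at_relation (f : Rep) c :
  rep_at f (left_arc c) =
  theta * rep_at f (right_arc c) + (1 - theta) * rep_at f (over_arc c).
Proof.
have evt : laurent_eval theta (laurent_t 'F_p) = theta.
  by rewrite laurent_eval_poly // horner_algX.
have ev1t : laurent_eval theta (1 - laurent_t 'F_p) = 1 - theta.
  have := laurent_evalD nz (1 - laurent_t 'F_p) (laurent_t 'F_p).
  by rewrite subrK evt (laurent_eval1 nz) => ->; rewrite addrK.
transitivity (laurent_eval theta (laurent_t 'F_p) * rep_at f (right_arc c)
   + laurent_eval theta (1 - laurent_t 'F_p) * rep_at f (over_arc c)).
  exact: (linear_comb f (arc_gen_relation p c)).
by rewrite evt ev1t.
Qed.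

(** The coefficients [t] and [1 - t] of each relation add up to 1. *)
Lemma constant_rep : exists f : Rep, forall a, rep_at f a = 1.
Proof.
have [c|f [flin fE]] := presented_module_map (r := @alexander_relation p D)
  (M := theta_module nz) (g := fun=> (1 : E)).
  by rewrite alexander_relation_sum -scalerDl [_ + (1 - _)]addrC subrK scale1r subrr.
by exists (mk_rep flin) => a; apply: fE.
Qed.

Hypothesis theta_neq1 : theta != 1.

(* By the relation at c the summand is, up to the factor 1 - theta, the
   variation of f along the understrand, so the sum telescopes along the link. *)
Lemma sum_sign_rep (f : Rep) :
  \sum_(c : crossing D) sign E c * (rep_at f (right_arc c) - rep_at f (over_arc c)) = 0.
Proof.
have t1 : theta - 1 != 0 by rewrite subr_eq0.
apply: (mulfI t1); rewrite mulr0 mulr_sumr.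
rewrite -[RHS](sum_under_arcs (rep_at f)); apply: eq_bigr => c _.
have := rep_at_relation f c; rewrite /left_arc /right_arc /sign.
have pos (a b o : E) : a = theta * b + (1 - theta) * o ->
  (theta - 1) * (1 * (b - o)) = a - b by move=> ->; ring.
have neg (a b o : E) : a = theta * b + (1 - theta) * o ->
  (theta - 1) * (- 1 * (b - o)) = b - a by move=> ->; ring.
by case: positive => [/pos|/neg].
Qed.

(** With the constant moved to the second slot by Hermitian symmetry, what remains is [ii] times the
    telescoping sum. *)
Lemma eta_constant_rep (f g : Rep) : (forall a, rep_at f a = 1) -> eta f g = 0.
Proof.
move=> f1; rewrite eta_conj; suff -> : eta g f = 0 by exact: conj0.
rewrite -[RHS](mulr0 ii) -[in RHS](sum_sign_rep g) mulr_sumr.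
by apply: eq_bigr => c _; rewrite !f1 conj1; ring.
Qed.

End EtaForm.

(** * The radical *)

Section Radical.
Import passmx.
Variables (K : fieldType) (V : vectType K).

(** The vectors whose coordinates form a row basis of [M] are a basis of the subspace. *)
Lemma dim_vsof (e : (\dim {:V}).-tuple V) (M : 'M_(\dim {:V})) :
  basis_of {:V} e -> \dim (vsof e M) = \rank M.
Proof.
move=> eb; pose v i := vecof e (row i (row_base M)).
pose X := [tuple v i | i < \rank M].
have XE (i : 'I_(\rank M)) : X`_i = v i by rewrite -tnth_nth tnth_mktuple.
have sumX (c : 'I_(\rank M) -> K) :
    \sum_i c i *: X`_i = vecof e ((\row_i c i) *m row_base M).
  rewrite mulmx_sum_row linear_sum; apply: eq_bigr => i _.
  by rewrite linearZ /= XE mxE.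
have freeX : free X.
  apply/freeP => c; rewrite sumX => /eqP; rewrite vecof_eq0 // => /eqP c0 i.
  have /(row_free_inj (row_base_free M))/rowP/(_ i) :
    (\row_i c i) *m row_base M = 0 *m row_base M by rewrite c0 mul0mx.
  by rewrite !mxE.
suff -> : vsof e M = <<X>>%VS by rewrite (eqP freeX) size_tuple.
apply/vspaceP => x; rewrite -rVof_sub // -(eq_row_base M).
apply/submxP/idP => [[u uE]|/coord_span xE].
  have uE' : \row_i u 0 i = u by apply/rowP => i; rewrite mxE.
  have -> : x = \sum_i u 0 i *: X`_i by rewrite sumX uE' -uE rVofK.
  by apply: rpred_sum => i _; rewrite rpredZ // memv_span // mem_nth // size_tuple.
by exists (\row_i coord X i x); rewrite {1}xE sumX vecofK.
Qed.

Variables (form : V -> V -> K) (c : K -> K).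
Hypothesis formD : forall x y z, form (x + y) z = form x z + form y z.
Hypothesis formZ : forall k x y, form (k *: x) y = k * form x y.
Hypothesis formC : forall x y, form y x = c (form x y).
Hypothesis c0 : c 0 = 0.

(** The radical is the left kernel of the Gram matrix. Only the first slot is linear, so vanishing
    on basis vectors in the second slot is extended to all vectors through [formC]. *)
Lemma radical_exists :
  exists2 W, is_radical form W & \dim W = (\dim {:V} - form_rank form)%N.
Proof.
pose b := vbasis {:V}; have bb : basis_of {:V} b := vbasisP _.
have form0 y : form 0 y = 0 by rewrite -(scale0r 0) formZ mul0r.
have form_sum m (x : 'I_m -> V) k y :
    form (\sum_i k i *: x i) y = \sum_i k i * form (x i) y.
  rewrite (big_morph (form^~ y) (fun u v => formD u v y) (form0 y)).
  by apply: eq_bigr => i _; rewrite formZ.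
exists (vsof b (kermx (gram_matrix form))); last by rewrite dim_vsof // mxrank_ker.
move=> f; rewrite -rVof_sub //; split=> [/sub_kermxP fG g|fg].
  rewrite formC (coord_basis bb (memvf g)) form_sum big1 ?c0 // => j _.
  rewrite formC {1}(coord_basis bb (memvf f)) form_sum.
  have /rowP/(_ j) := fG; rewrite !mxE => e.
  rewrite (_ : \sum_i _ = 0) ?c0 ?mulr0 // -[RHS]e.
  by apply: eq_bigr => i _; rewrite !mxE.
apply/sub_kermxP/rowP => j; rewrite !mxE -[RHS](fg b`_j).
rewrite [in RHS](coord_basis bb (memvf f)) form_sum.
by apply: eq_bigr => i _; rewrite !mxE.
Qed.

End Radical.

(** * The cocycle invariant and the nullity of a link diagram *)

Theorem theorem2p1 (p : nat) (p_prime : prime p)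
    (E : fieldExtType 'F_p) (dimE : \dim {:E} = 2%N)
    (theta : E) (theta_gen : <<1; theta>>%VS = {:E}%VS)
    (theta_norm : theta * conj theta = 1)
    (kappa : 'F_p)
    (theta_min : minPoly 1%VS theta
                 = map_poly (in_alg E) ('X^2 + kappa *: 'X + 1))
    (ii : E) (ii_neq0 : ii != 0) (ii_conj : conj ii = - ii)
    (gT : finGroupType) (card_gT : #|gT| = p)
    (u : gT) (u_gen : <[u]>%g = [set: gT])
    (D : link_diagram) :
  let nz := norm1_neq0 theta_norm in
  let h := 'X^2 + kappa *: 'X + 1 in
  let r := form_rank (@eta p E theta nz ii D) in
  let s := (nu D h + nu_0 p D - r)%N in
  [/\ cocycle_invariant nz ii D u = Gamma p u ^+ r * (p ^ (2 * s))%:R,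
      exists2 W : {vspace Rep nz D},
        is_radical (eta (D := D) ii) W & \dim W = s
    & (0 < s)%N].
Proof.
move=> nz h r s.
(* Otherwise [theta] would generate only F_p, of dimension 1. *)
have theta1 : theta != 1.
  apply: contra_eq_neq dimE => t1.
  by rewrite -theta_gen t1 (Fadjoin_idP (mem1v _)) dimv1.
pose V : finLmodType E := Rep nz D.
have dimR : \dim {:Rep nz D} = (nu D h + nu_0 p D)%N := dim_Rep nz D theta_min.
have etaC := @eta_conj p p_prime E dimE theta nz ii ii_conj D.
have [W Wrad dimW] := radical_exists (@etaD p E theta nz ii D) (@etaZ p E theta nz ii D)
  etaC (conj0 p_prime E).
have sE : s = \dim W by rewrite dimW dimR.
have le_r : (r <= \dim {:Rep nz D})%N by exact: rank_leq_row.
have nE : (r + s = \dim {:Rep nz D})%N by rewrite sE dimW subnKC.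
have cardE := card_E p_prime dimE.
have card_sub (U : {vspace Rep nz D}) : #|U| = (p ^ (2 * \dim U))%N.
  rewrite expnM -cardE.
  exact: (@card_vspace (finvect_type E) (Rep nz D) (Vector.class (Rep nz D)) U).
have cardV : #|V| = (p ^ (2 * (r + s)))%N.
  by rewrite nE -card_sub; apply/esym/eq_card => f; rewrite memvf.
have cardW : #|@radical_set (finvect_type E) V (@eta p E theta nz ii D)|
    = (p ^ (2 * s))%N.
  rewrite sE -card_sub; apply: eq_card => f; rewrite inE.
  apply/forallP/idP => [e|/Wrad e g]; last by rewrite e.
  by apply/Wrad => g; apply/eqP/e.
have etaB := boltzmann_eta p_prime dimE ii_conj (nz := nz) (D := D).
split; last 2 first.
- by exists W; rewrite ?sE.
- have [f f1] := constant_rep nz D.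
  rewrite sE lt0n dimv_eq0; apply/eqP => W0.
  have : f \in W by apply/Wrad => g; apply: (eta_constant_rep p_prime dimE ii_conj theta1 g f1).
  rewrite W0 memv0 => /eqP f0.
  (* A link has at least one arc, so the constant representation 1 is a nonzero vector of the
     radical. *)
  have [a] := link_has_arc D.
  have := f1 a; rewrite f0 => /esym/eqP; rewrite oner_eq0 //.
pose B : V -> 'F_p := boltzmann_weight ii (D := D).
have diff := @level_diff p p_prime (finvect_type E) cardE (in_alg (finvect_type E)) V
  (@eta p E theta nz ii D) B (@etaD p E theta nz ii D) (@etaZ p E theta nz ii D) etaC etaB
  (r + s) s (leq_addl _ _) cardV cardW.
have total := @sum_level p p_prime (finvect_type E) cardE (in_alg (finvect_type E)) V
  (@eta p E theta nz ii D) B (@etaZ p E theta nz ii D) etaC etaB.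
have const := @card_level p p_prime (finvect_type E) cardE (in_alg (finvect_type E)) V
  (@eta p E theta nz ii D) B (@etaZ p E theta nz ii D) etaC etaB.
rewrite addnK in diff; rewrite cardV in total.
rewrite /cocycle_invariant (sum_gr_elt p_prime card_gT u_gen (erefl _) const).
exact: (Gamma_expE p_prime card_gT u_gen diff (esym total)).
Qed.
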